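(* For any $q>1$ and $\varepsilon>0$ there exists a constant $\alpha'(q,\varepsilon)$ such that for all $s\ge v\ge0$, as $\gamma\to\infty$, $$\mathbb{P}\Big(\sup_{x\in\mathcal{J}}\big|\hat p^{\mathrm{a}}(s)-\tilde p^{\mathrm{a}}(s)\big|(x,\mathcal{J})\ge(s+1)\,\alpha'(q,\varepsilon)\,(\log\gamma)\,\gamma^{-1/2+\varepsilon/2}\Big)=o(\gamma^{-q}),$$ $$\mathbb{P}\Big(\sup_{x\in\mathcal{J}}\int_0^v\big|\hat p^{\mathrm{c}}(s,v')-\tilde p^{\mathrm{c}}(s,v')\big|(x,\mathcal{J})\,\mathrm{d}v'\ge(s+1)\,\alpha'(q,\varepsilon)\,(\log\gamma)\,\gamma^{-1/2+\varepsilon/2}\Big)=o(\gamma^{-q}).$$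
   Context: $\mathrm{Poi}_\lambda(k)=e^{-\lambda}\lambda^k/k!$ for $k\ge 0$, and $\mathrm{Erl}_{k,\lambda}(x)=\lambda(\lambda x)^{k-1}e^{-\lambda x}/(k-1)!$ for $k\ge1$, $x\ge0$. For a signed kernel $A$ on a measurable space, $|A|(x,\cdot)$ denotes the total variation measure of the signed measure $A(x,\cdot)$; the composition of kernels is $(AB)(x,\mathrm{d}y)=\int A(x,\mathrm{d}x')B(x',\mathrm{d}y)$. $(\mathcal{J},\mathscr{J})$ is a measurable space such that $\{x\}\in\mathscr{J}$ for all $x\in\mathcal{J}$. $\{\Lambda(s,v)\}_{s,v\ge0}$ is a family of signed (intensity) kernels on $(\mathcal{J},\mathscr{J})$ such that for all $x\in\mathcal{J}$, $A\in\mathscr{J}$ the maps $s\mapsto\Lambda(s,v)(x,A)$ (each $v$) and $v\mapsto\Lambda(s,v)(x,A)$ (each $s$) are c\`adl\`ag, and $\sup_{s,v\ge0,\,x\in\mathcal{J}}|\Lambda|(s,v)(x,\{x\})\le\gamma_0<\infty$. The Hahn–Jordan decomposition $\Lambda(s,v)(x,\cdot)=\Lambda^+(s,v)(x,\cdot)-\Lambda^-(s,v)(x,\cdot)$ has $\Lambda^+(s,v)(x,\cdot)$ supported on $\mathcal{J}\setminus\{x\}$, $\Lambda^-(s,v)(x,\cdot)$ supported on $\{x\}$, and $\Lambda^-(s,v)(x,\{x\})=\Lambda^+(s,v)(x,\mathcal{J}\setminus\{x\})$. It is assumed that there exists $K>0$ such that for all $x\in\mathcal{J}$ and $s_1,s_2,v_1,v_2\ge0$,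 $$|\Lambda(s_1,v_1)-\Lambda(s_2,v_2)|(x,\mathcal{J})\le K(|s_1-s_2|+|v_1-v_2|).$$ For $\gamma\ge\gamma_0$ let $\chi_0=0<\chi_1<\chi_2<\cdots$ be the arrival times of a Poisson process of intensity $\gamma$. For integers $\ell\ge w\ge0$ define the kernels $$Q^{\mathrm{d}}(\ell,w)(x,\mathrm{d}y)=\delta_x(\mathrm{d}y)-\tfrac1\gamma\Lambda^-(\chi_{\ell+1},\chi_{\ell+1}-\chi_{\ell-w})(x,\mathrm{d}y),\qquad Q^{\mathrm{n}}(\ell,w)(x,\mathrm{d}y)=\tfrac1\gamma\Lambda^+(\chi_{\ell+1},\chi_{\ell+1}-\chi_{\ell-w})(x,\mathrm{d}y),$$ $$\tilde Q^{\mathrm{d}}(\ell,w)(x,\mathrm{d}y)=\delta_x(\mathrm{d}y)-\tfrac1\gamma\Lambda^-\big(\tfrac{\ell+1}\gamma,\tfrac{w+1}\gamma\big)(x,\mathrm{d}y),\qquad \tilde Q^{\mathrm{n}}(\ell,w)(x,\mathrm{d}y)=\tfrac1\gamma\Lambda^+\big(\tfrac{\ell+1}\gamma,\tfrac{w+1}\gamma\big)(x,\mathrm{d}y).$$ The kernels $\Pi(\ell,w)$ are given by $\Pi(0,0)(x,\mathrm{d}y)=\delta_x(\mathrm{d}y)$; $\Pi(k,v)=0$ for $v>k$; $\Pi(k,0)=\sum_{k'=0}^{k-1}\Pi(k-1,k')Q^{\mathrm{n}}(k-1,k')$ for $k\ge1$; $\Pi(k,v)=\Pi(k-1,v-1)Q^{\mathrm{d}}(k-1,v-1)$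 for $k\ge v\ge1$. The kernels $\tilde\Pi(\ell,w)$ are given by the same recursion with $\tilde Q^{\mathrm{n}},\tilde Q^{\mathrm{d}}$ in place of $Q^{\mathrm{n}},Q^{\mathrm{d}}$. The (random) grid-conditional kernels are $$\hat p^{\mathrm{a}}(s)(x,\mathrm{d}y)=\sum_{\ell\ge0}\mathrm{Poi}_{\gamma s}(\ell)\,\Pi(\ell,\ell)(x,\mathrm{d}y),\qquad \hat p^{\mathrm{c}}(s,v)(x,\mathrm{d}y)=\sum_{\ell>w\ge0}\mathrm{Erl}_{\ell-w,\gamma}(s-v)\,\mathrm{Poi}_{\gamma v}(w)\,\Pi(\ell,w)(x,\mathrm{d}y)\,\mathbf 1_{\{v<s\}},$$ and $\tilde p^{\mathrm{a}}(s)$, $\tilde p^{\mathrm{c}}(s,v)$ (deterministic, unconditional) are defined by the same formulas with $\tilde\Pi$ in place of $\Pi$. All of these depend on $\gamma$. *)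

(* Defs.v *)
From HB Require Import structures.
From mathcomp Require Import all_boot all_order all_algebra.
From mathcomp Require Import all_classical all_reals all_analysis.
From mathcomp Require Import measurable_realfun.
Set Implicit Arguments.
Unset Strict Implicit.
Unset Printing Implicit Defensive.
Import Order.TTheory GRing.Theory Num.Theory.
Import numFieldNormedType.Exports.
Local Open Scope classical_set_scope.
Local Open Scope ring_scope.

Definition Poi {R : realType} (lambda : R) (k : nat) : R :=
  expR (- lambda) * lambda ^+ k / k`!%:R.

(* Meaningful for 1 <= k and 0 <= x. *)
Definition Erl {R : realType} (k : nat) (lambda x : R) : R :=
  lambda * (lambda * x) ^+ k.-1 * expR (- (lambda * x)) / (k.-1)`!%:R.

(* Right-continuous on [0, +oo[ with left limits on ]0, +oo[; the values of f
   at negative arguments play no role. *)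
Definition cadlag_on_Rplus {R : realType} (f : R -> R) : Prop :=
  (forall t, 0 <= t -> f x @[x --> t^'+] --> f t) /\
  (forall t, 0 < t -> cvg (f x @[x --> t^'-])).

(* Total variation of a countably additive set function.  It is defined on bare
   set functions so that it applies to differences of kernels given by series;
   on charges it is the library's charge_variation, see tvE below. *)
Definition tv {d} {T : measurableType d} {R : realType} (nu : set T -> \bar R)
    (A : set T) : \bar R :=
  ereal_sup [set s | exists n (F : 'I_n -> set T),
    [/\ forall i, measurable (F i), trivIset setT F, \big[setU/set0]_(i < n) F i = A
      & s = (\sum_(i < n) `|nu (F i)|)%E]].

Lemma tvE {d} {T : measurableType d} {R : realType}
    (nu : {charge set T -> \bar R}) (P N : set T)
    (nuPN : hahn_decomposition nu P N) (A : set T) :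
  measurable A -> tv nu A = charge_variation nuPN A.
Proof.
move=> mA; have [[mP posP] [mN negN] _ PN0] := nuPN.
apply/eqP; rewrite eq_le; apply/andP; split.
  apply: ge_ereal_sup => _ [n [F [mF tF <- ->]]].
  rewrite (measure_bigsetU_ord (charge_variation nuPN) xpredT) //.
  by apply: lee_sum => i _; exact: abse_charge_variation.
have AP0 : (0 <= nu (A `&` P))%E by apply: posP; [exact: measurableI|].
have AN0 : (nu (A `&` N) <= 0)%E by apply: negN; [exact: measurableI|].
apply: ereal_sup_ubound.
exists 2, (fun i => if i == ord0 then A `&` P else A `&` N); split.
- by move=> i; case: ifP => _; exact: measurableI.
- apply/trivIsetP => i j _ _.
  have disj : (A `&` P) `&` (A `&` N) = set0 by rewrite setIACA PN0 setI0.
  by move: i j => [[|[|//]] ?] [[|[|//]] ?] //= _; rewrite // setIC.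
- rewrite !big_ord_recl big_ord0 /= setU0 -setIUr.
  by have [_ _ -> _] := nuPN; rewrite setIT.
- rewrite !big_ord_recl big_ord0 /= adde0 gee0_abs// lee0_abs//.
  by rewrite /charge_variation/= jordan_posE jordan_negE cjordan_posE
    cjordan_negE /crestr0 mem_set.
Qed.

Definition hahn_P {d} {T : measurableType d} {R : realType}
    (nu : {charge set T -> \bar R}) : set T :=
  sval (cid (Hahn_decomposition nu)).

Definition hahn_N {d} {T : measurableType d} {R : realType}
    (nu : {charge set T -> \bar R}) : set T :=
  sval (cid (svalP (cid (Hahn_decomposition nu)))).

Lemma hahn_PN {d} {T : measurableType d} {R : realType}
    (nu : {charge set T -> \bar R}) :
  hahn_decomposition nu (hahn_P nu) (hahn_N nu).
Proof. exact: svalP (cid (svalP (cid (Hahn_decomposition nu)))). Qed.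

(* The Jordan parts do not depend on the Hahn decomposition that is chosen. *)
Definition pos_part {d} {T : measurableType d} {R : realType}
    (nu : {charge set T -> \bar R}) : {measure set T -> \bar R} :=
  jordan_pos (hahn_PN nu).

Definition neg_part {d} {T : measurableType d} {R : realType}
    (nu : {charge set T -> \bar R}) : {measure set T -> \bar R} :=
  jordan_neg (hahn_PN nu).

(* Standing assumptions on the intensity kernels.  Only nonnegative s and v
   matter.  A signed kernel is a map into charges (finite signed measures); the
   bound on the diagonal and the balance condition make the total mass finite.
   The Jordan parts are required to be kernels: their measurability in x does
   not follow from that of Lambda on an arbitrary measurable space. *)
Record intensity_family {d} {J : measurableType d} {R : realType} (gamma0 : R)
    (Lambda : R -> R -> J -> {charge set J -> \bar R}) : Prop :=
  IntensityFamily {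
    intensity_pos_kernel : forall (s v : R) A, 0 <= s -> 0 <= v -> measurable A ->
      measurable_fun setT (fun x => pos_part (Lambda s v x) A : \bar R);
    intensity_neg_kernel : forall (s v : R) A, 0 <= s -> 0 <= v -> measurable A ->
      measurable_fun setT (fun x => neg_part (Lambda s v x) A : \bar R);
    intensity_cadlag1 : forall v x A, 0 <= v -> measurable A ->
      cadlag_on_Rplus (fun s => fine (Lambda s v x A));
    intensity_cadlag2 : forall s x A, 0 <= s -> measurable A ->
      cadlag_on_Rplus (fun v => fine (Lambda s v x A));
    intensity_bound : forall (s v : R) x, 0 <= s -> 0 <= v ->
      (tv (Lambda s v x) [set x] <= gamma0%:E)%E;
    intensity_pos_supp : forall (s v : R) x, 0 <= s -> 0 <= v ->
      pos_part (Lambda s v x) [set x] = 0%E;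
    intensity_neg_supp : forall (s v : R) x, 0 <= s -> 0 <= v ->
      neg_part (Lambda s v x) (~` [set x]) = 0%E;
    intensity_balance : forall (s v : R) x, 0 <= s -> 0 <= v ->
      neg_part (Lambda s v x) [set x] = pos_part (Lambda s v x) (~` [set x]);
    intensity_lipschitz : exists2 K : R, 0 < K &
      forall x s1 s2 v1 v2, 0 <= s1 -> 0 <= s2 -> 0 <= v1 -> 0 <= v2 ->
      (tv (fun A => Lambda s1 v1 x A - Lambda s2 v2 x A) setT
        <= (K * (`|s1 - s2| + `|v1 - v2|))%:E)%E }.

Definition mutually_independent {d} {Omega : measurableType d} {R : realType}
    (P : probability Omega R) (X : nat -> Omega -> R) : Prop :=
  forall (I : seq nat) (B : nat -> set R), uniq I ->
    (forall i, measurable (B i)) ->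
    P (\bigcap_(i in [set` I]) (X i @^-1` B i)) =
      (\prod_(i <- I) P (X i @^-1` B i))%E.

(* chi 0 = 0 < chi 1 < chi 2 < ... are the arrival times of a Poisson process of
   intensity gamma: the interarrival times are i.i.d. exponential. *)
Record poisson_arrivals {d} {Omega : measurableType d} {R : realType}
    (P : probability Omega R) (gamma : R) (chi : nat -> {RV P >-> R}) : Prop :=
  PoissonArrivals {
    arrivals0 : forall w, chi 0%N w = 0;
    arrivals_lt : forall n w, chi n w < chi n.+1 w;
    arrivals_indep :
      mutually_independent P (fun n w => chi n.+1 w - chi n w);
    arrivals_exp : forall n B, measurable B ->
      P ((fun w => chi n.+1 w - chi n w) @^-1` B) = exponential_prob gamma B }.

(* Composition AB; A x is always a (nonnegative) measure where this is used. *)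
Definition kernel_mul {d} {J : measurableType d} {R : realType}
    (A B : J -> set J -> \bar R) (x : J) (U : set J) : \bar R :=
  (\int[A x]_y B y U)%E.

Definition Qdiag {d} {J : measurableType d} {R : realType} (gamma : R)
    (Lambda : R -> R -> J -> {charge set J -> \bar R}) (s v : R)
    (x : J) (U : set J) : \bar R :=
  (\d_x U - (gamma^-1)%:E * neg_part (Lambda s v x) U)%E.

Definition Qjump {d} {J : measurableType d} {R : realType} (gamma : R)
    (Lambda : R -> R -> J -> {charge set J -> \bar R}) (s v : R)
    (x : J) (U : set J) : \bar R :=
  ((gamma^-1)%:E * pos_part (Lambda s v x) U)%E.

Fixpoint Pi {d} {J : measurableType d} {R : realType}
    (Qd Qn : nat -> nat -> J -> set J -> \bar R) (l w : nat) :
    J -> set J -> \bar R :=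
  match l, w with
  | 0, 0 => fun x U => \d_x U
  | 0, _.+1 => fun _ _ => 0%E
  | k.+1, 0 => fun x U =>
      (\sum_(k' < k.+1) kernel_mul (Pi Qd Qn k k') (Qn k k') x U)%E
  | k.+1, v.+1 => fun x U =>
      if (v <= k)%N then kernel_mul (Pi Qd Qn k v) (Qd k v) x U else 0%E
  end.

(* chi is one realization of the arrival times. *)
Definition Pi_hat {d} {J : measurableType d} {R : realType} (gamma : R)
    (Lambda : R -> R -> J -> {charge set J -> \bar R}) (chi : nat -> R) :
    nat -> nat -> J -> set J -> \bar R :=
  Pi (fun l w => Qdiag gamma Lambda (chi l.+1) (chi l.+1 - chi (l - w)%N))
     (fun l w => Qjump gamma Lambda (chi l.+1) (chi l.+1 - chi (l - w)%N)).

Definition Pi_tilde {d} {J : measurableType d} {R : realType} (gamma : R)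
    (Lambda : R -> R -> J -> {charge set J -> \bar R}) :
    nat -> nat -> J -> set J -> \bar R :=
  Pi (fun l w => Qdiag gamma Lambda (l.+1%:R / gamma) (w.+1%:R / gamma))
     (fun l w => Qjump gamma Lambda (l.+1%:R / gamma) (w.+1%:R / gamma)).

(* For gamma0 <= gamma the kernels PI l w below are nonnegative, so that the
   series are sums of nonnegative terms, with total mass finite. *)
Definition p_a {d} {J : measurableType d} {R : realType} (gamma : R)
    (PI : nat -> nat -> J -> set J -> \bar R) (s : R) (x : J) (U : set J) :
    \bar R :=
  (\sum_(0 <= l <oo) (Poi (gamma * s) l)%:E * PI l l x U)%E.

Definition p_c {d} {J : measurableType d} {R : realType} (gamma : R)
    (PI : nat -> nat -> J -> set J -> \bar R) (s v : R) (x : J) (U : set J) :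
    \bar R :=
  if v < s then
    (\esum_(lw in [set lw : nat * nat | (lw.2 < lw.1)%N])
      ((Erl (lw.1 - lw.2) gamma (s - v) * Poi (gamma * v) lw.2)%:E
        * PI lw.1 lw.2 x U))%E
  else 0%E.

Definition phat_a {d} {J : measurableType d} {R : realType} (gamma : R)
    (Lambda : R -> R -> J -> {charge set J -> \bar R}) (chi : nat -> R) :=
  p_a gamma (Pi_hat gamma Lambda chi).

Definition phat_c {d} {J : measurableType d} {R : realType} (gamma : R)
    (Lambda : R -> R -> J -> {charge set J -> \bar R}) (chi : nat -> R) :=
  p_c gamma (Pi_hat gamma Lambda chi).

Definition ptilde_a {d} {J : measurableType d} {R : realType} (gamma : R)
    (Lambda : R -> R -> J -> {charge set J -> \bar R}) :=
  p_a gamma (Pi_tilde gamma Lambda).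

Definition ptilde_c {d} {J : measurableType d} {R : realType} (gamma : R)
    (Lambda : R -> R -> J -> {charge set J -> \bar R}) :=
  p_c gamma (Pi_tilde gamma Lambda).

Definition error_a {d} {J : measurableType d} {R : realType} (gamma : R)
    (Lambda : R -> R -> J -> {charge set J -> \bar R}) (chi : nat -> R)
    (s : R) : \bar R :=
  ereal_sup [set tv (fun U => phat_a gamma Lambda chi s x U
                              - ptilde_a gamma Lambda s x U)%E setT
            | x in [set: J]].

Definition error_c {d} {J : measurableType d} {R : realType} (gamma : R)
    (Lambda : R -> R -> J -> {charge set J -> \bar R}) (chi : nat -> R)
    (s v : R) : \bar R :=
  ereal_sup [set (\int[lebesgue_measure]_(v' in `[0%R, v])
                   tv (fun U => phat_c gamma Lambda chi s v' x U
                                - ptilde_c gamma Lambda s v' x U) setT)%E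
            | x in [set: J]].

(* Main.v *)
(* Both kernels come from the same recursion: the deterministic one is obtained
   from the random one by replacing the arrival times chi_k by the grid points
   k / gamma.  One step of the recursion is a Markov step on pairs (state,
   duration), so the differences of the kernels at step l, summed over all
   durations, have total variation at most (l / gamma) times a constant times
   max_(k <= l) |chi_k - k / gamma|, and at most 2.  For p^c the weights are
   integrated over v' first: the integral of Erl_(l - w)(s - v') Poi(v')(w) is a
   beta integral, at most Poi_(gamma s)(l).  So both errors are at most the
   Poisson average over l of these total variations.  The Poisson tail beyond
   O(gamma) is exponentially small, and Chernoff bounds for sums of exponential
   variables give |chi_k - k / gamma| = O(log gamma / sqrt gamma) for all
   k = O(gamma), up to an event of probability O(gamma^(-q-1)). *)
Require Import Defs.
From HB Require Import structures.
From mathcomp Require Import all_boot all_order all_algebra.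
From mathcomp Require Import all_classical all_reals all_analysis.
From mathcomp Require Import measurable_realfun ring lra.
Set Implicit Arguments.
Unset Strict Implicit.
Unset Printing Implicit Defensive.
Import Order.TTheory GRing.Theory Num.Theory.
Import numFieldNormedType.Exports.
Import HBNNSimple.
Local Open Scope classical_set_scope.
Local Open Scope ring_scope.

Local Open Scope ereal_scope.

(** * Images of measures under kernels *)

(** The object of study is the error as a function of an arbitrary nonnegative nondecreasing
    sequence of arrival times. Its key property is a stability estimate: if two sequences differ by
    at most [r] up to index [L], the error of one exceeds that of the other by at most
    [error_bound], uniformly in the state. The estimate is used twice. Against [grid gamma], where
    the error is at most 0, it bounds the error; between two arbitrary realizations it shows that
    the error event is measurable. To serve both uses, the comparison lemmas subtract a common
    kernel [g] from both sides instead of comparing the two kernels directly.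

    The errors grow only linearly in the number of steps because the diagonal and the jump kernel
    add up to a Markov kernel: each level of the recursion, summed over the durations, has mass
    exactly 1, and errors made earlier are transported without being amplified. *)

Lemma charge_dominated d (T : measurableType d) (R : realType)
    (nu : {charge set T -> \bar R}) :
  exists m : {measure set T -> \bar R}, m setT = tv nu setT /\
    forall A, measurable A -> `|nu A| <= m A.
Proof.
have [P [N nuPN]] := Hahn_decomposition nu.
exists (charge_variation nuPN); split; first by rewrite (tvE nuPN).
exact: abse_charge_variation.
Qed.

(** [Pi] integrates against bare set functions that are known to agree with a measure only on
    measurable sets. This suffices, since the integral is a supremum over simple functions, whose
    level sets are measurable. *)
Lemma eq_integral_setfun d (T : measurableType d) (R : realType)
    (m1 m2 : set T -> \bar R) (f : T -> \bar R) :
  (forall A, measurable A -> m1 A = m2 A) ->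
  \int[m1]_x f x = \int[m2]_x f x.
Proof.
move=> m12; have eqs (h : {nnsfun T >-> R}) : sintegral m1 h = sintegral m2 h.
  by rewrite /sintegral; apply: eq_fsbigr => x _; rewrite m12.
have eqn (g : T -> \bar R) :
    [set sintegral m1 h | h in [set h : {nnsfun T >-> R} | forall x, (h x)%:E <= g x]] =
    [set sintegral m2 h | h in [set h : {nnsfun T >-> R} | forall x, (h x)%:E <= g x]].
  by apply/seteqP; split=> _ [h hf <-]; exists h => //; rewrite eqs.
by rewrite /integral !eqn.
Qed.

(* The integral of a nonnegative function is a supremum over simple functions
   below it, hence monotone without measurability. *)
Lemma ge0_le_integral_lower d (T : measurableType d) (R : realType)
    (mu : {measure set T -> \bar R}) (D : set T) (f g : T -> \bar R) :
  (forall x, D x -> 0 <= f x) -> (forall x, D x -> f x <= g x) ->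
  \int[mu]_(x in D) f x <= \int[mu]_(x in D) g x.
Proof.
move=> f0 fg.
have g0 x : D x -> 0 <= g x by move=> Dx; exact: le_trans (f0 _ Dx) (fg _ Dx).
rewrite integral_mkcond [leRHS]integral_mkcond !ge0_integralTE; last 2 first.
- by move=> x; rewrite patchE; case: ifPn => // /set_mem /g0.
- by move=> x; rewrite patchE; case: ifPn => // /set_mem /f0.
apply: le_ereal_sup => _ [h hf <-]; exists h => // x.
apply: le_trans (hf x) _; rewrite !patchE; case: ifPn => // /set_mem; exact: fg.
Qed.

Section kernel_image.
Context d (T : measurableType d) (R : realType) (mu : {measure set T -> \bar R}).
Variable K : T -> {measure set T -> \bar R}.
Hypothesis mK : forall A, measurable A -> measurable_fun setT (fun y => K y A).

(** The measurability proof is an explicit argument so that the measure structure declared below,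
    which depends on it, can be inferred from the term. *)
Definition kimage of (forall A, measurable A -> measurable_fun setT (fun y => K y A)) := fun A => \int[mu]_y K y A.

Let kimage0 : kimage mK set0 = 0.
Proof.
by rewrite /kimage; under eq_integral do rewrite measure0; rewrite integral0.
Qed.

Let kimage_ge0 A : 0 <= kimage mK A. Proof. exact: integral_ge0. Qed.

Let kimage_sigma_additive : semi_sigma_additive (kimage mK).
Proof.
move=> U mU tU mUU; rewrite [X in _ --> X](_ : _ =
  \int[mu]_y (\sum_(n <oo) K y (U n))); last first.
  apply: eq_integral => V _.
  by apply/esym/cvg_lim => //; exact/measure_semi_sigma_additive.
apply/cvg_closeP; split.
  by apply: is_cvg_nneseries => n _ _; exact: integral_ge0.
by rewrite closeE// integral_nneseries// => n; exact: mK.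
Qed.

HB.instance Definition _ := isMeasure.Build _ _ R
  (kimage mK) kimage0 kimage_ge0 kimage_sigma_additive.

End kernel_image.

(* Differences of kernels are compared through dominating measures instead of
   total variations: the total variation of the difference of two kernels need
   not be measurable on an arbitrary measurable space, so it cannot be
   integrated. *)
Definition dominated_diff d (T : measurableType d) (R : realType)
    (a b n : set T -> \bar R) :=
  forall A, measurable A -> a A <= b A + n A /\ b A <= a A + n A.

Lemma dominated_diff_integral d (T : measurableType d) (R : realType)
    (a b n : {measure set T -> \bar R}) (f : T -> \bar R) :
  dominated_diff a b n -> (forall x, 0 <= f x) -> measurable_fun setT f ->
  \int[a]_x f x <= \int[b]_x f x + \int[n]_x f x.
Proof.
move=> abn f0 mf; rewrite -ge0_integral_measure_add//.
apply: ge0_le_measure_integral => // A mA.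
by rewrite /measure_add/= /msum !big_ord_recl/= big_ord0 adde0; have [] := abn A mA.
Qed.

Section fmeasure.
Context d (T : measurableType d) (R : realType) (m : {measure set T -> \bar R}).
Hypothesis mfin : m setT < +oo.

(** An alias of [m] that carries the proof of finiteness, so that the finite measure structure is
    inferred and [m] can be turned into a charge. *)
Definition fmeasure of m setT < +oo := (m : set T -> \bar R).

HB.instance Definition _ := Measure.on (fmeasure mfin).

Let fmeasure_fin : fin_num_fun (fmeasure mfin).
Proof.
move=> A mA; rewrite ge0_fin_numE//; apply: le_lt_trans mfin.
by apply: le_measure; rewrite ?inE.
Qed.

HB.instance Definition _ := @Measure_isFinite.Build _ _ _ (fmeasure mfin)
  fmeasure_fin.

End fmeasure.

(** Finiteness makes [a - b] a charge; its variation measure is the witness. *)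
Lemma finite_measures_dominated d (T : measurableType d) (R : realType)
    (a b : {measure set T -> \bar R}) (e : \bar R) :
  a setT < +oo -> b setT < +oo ->
  tv (fun A => a A - b A) setT <= e ->
  exists n : {measure set T -> \bar R}, n setT <= e /\ dominated_diff a b n.
Proof.
move=> afin bfin abe.
pose nu := cadd (charge_of_finite_measure (fmeasure afin))
  (copp (charge_of_finite_measure (fmeasure bfin))).
have [n [nT nA]] := charge_dominated nu.
exists n; split; first by rewrite nT.
move=> A mA; have : `|a A - b A| <= n A := nA A mA.
have : b A \is a fin_num := fin_num_measure (fmeasure bfin) A mA.
have : a A \is a fin_num := fin_num_measure (fmeasure afin) A mA.
case: (a A) => // x _; case: (b A) => // y _.
case: (n A) => [z| |] //=; last by rewrite !leey.
rewrite !lee_fin ler_norml => /andP[? ?]; split; lra.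
Qed.

Lemma abse_sub_le (R : realType) (a b c : \bar R) : a \is a fin_num ->
  b \is a fin_num -> a <= b + c -> b <= a + c -> `|a - b| <= c.
Proof.
case: a => // x _; case: b => // y _; case: c => [z| |] //=; rewrite ?leey//.
by rewrite !lee_fin => ? ?; rewrite ler_norml; apply/andP; split; lra.
Qed.

Lemma dominated_diffC d (T : measurableType d) (R : realType)
    (a b n : set T -> \bar R) : dominated_diff a b n -> dominated_diff b a n.
Proof. by move=> h A /h[]. Qed.

Section subprobability_kernel.
Context d (T : measurableType d) (R : realType).
Variable K : T -> {measure set T -> \bar R}.
Hypothesis mK : forall A, measurable A -> measurable_fun setT (fun y => K y A).
Hypothesis K1 : forall y, K y setT <= 1.

Lemma kimage_le (mu : {measure set T -> \bar R}) : kimage mu mK setT <= mu setT.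
Proof.
rewrite -[leRHS]mul1e -[1]/(1%:E) -integral_cst// /kimage.
apply: ge0_le_integral => //; exact: mK.
Qed.

Lemma kernel_fin y A : measurable A -> K y A \is a fin_num.
Proof.
move=> mA; rewrite ge0_fin_numE//; apply: (@le_lt_trans _ _ 1); last exact: ltey.
by apply: le_trans (K1 y); apply: le_measure; rewrite ?inE.
Qed.

End subprobability_kernel.

Section kimage_dominated.
Context d (T : measurableType d) (R : realType).
Variables K K' : T -> {measure set T -> \bar R}.
Hypothesis mK : forall A, measurable A -> measurable_fun setT (fun y => K y A).
Hypothesis mK' : forall A, measurable A -> measurable_fun setT (fun y => K' y A).
Hypothesis K1 : forall y, K y setT <= 1.
Hypothesis K1' : forall y, K' y setT <= 1.
Variable e : R.
Hypothesis e0 : (0 <= e)%R.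
Hypothesis tvK : forall y, tv (fun A => K y A - K' y A) setT <= e%:E.

(** For one finite partition the sum of [|K y (F i) - K' y (F i)|] is measurable in [y] and at most
    [e]. It is integrated first, and the supremum over partitions is taken last. *)
Lemma tv_kimage (mu : {measure set T -> \bar R}) : mu setT < +oo ->
  tv (fun A => kimage mu mK A - kimage mu mK' A) setT <= e%:E * mu setT.
Proof.
move=> mufin; apply: ge_ereal_sup => _ [m [F [mF tF UF ->]]].
have mD i : measurable_fun setT (fun y => `|K y (F i) - K' y (F i)|).
  by apply: measurableT_comp => //; apply: emeasurable_funB; [exact: mK|exact: mK'].
have fin (k : {measure set T -> \bar R}) i : k setT <= mu setT ->
    k (F i) \is a fin_num.
  move=> kmu; rewrite ge0_fin_numE//; apply: le_lt_trans mufin.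
  by apply: le_trans kmu; apply: le_measure; rewrite ?inE.
have le1 i : kimage mu mK (F i) <= kimage mu mK' (F i)
    + \int[mu]_y `|K y (F i) - K' y (F i)|.
  rewrite -ge0_integralD//; last exact: mK'.
  apply: ge0_le_integral => //; first exact: mK.
    by apply: emeasurable_funD => //; exact: mK'.
  move=> y _; have := kernel_fin K1' y (mF i); have := kernel_fin K1 y (mF i).
  case: (K y _) => // a _; case: (K' y _) => // b _ /=.
  by rewrite lee_fin -lerBlDl ler_norm.
have le2 i : kimage mu mK' (F i) <= kimage mu mK (F i)
    + \int[mu]_y `|K y (F i) - K' y (F i)|.
  rewrite -ge0_integralD//; last exact: mK.
  apply: ge0_le_integral => //; first exact: mK'.
    by apply: emeasurable_funD => //; exact: mK.
  move=> y _; have := kernel_fin K1' y (mF i); have := kernel_fin K1 y (mF i).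
  case: (K y _) => // a _; case: (K' y _) => // b _ /=.
  by rewrite lee_fin -lerBlDl distrC ler_norm.
apply: (@le_trans _ _ (\sum_(i < m) \int[mu]_y `|K y (F i) - K' y (F i)|)).
  apply: lee_sum => i _; apply: abse_sub_le => //; apply: fin; exact: kimage_le.
rewrite -ge0_integral_sum// -integral_cst//.
apply: ge0_le_integral => //.
- by move=> y _; apply: sume_ge0.
- by apply: emeasurable_sum.
- move=> y _; apply: le_trans (tvK y); apply: ereal_sup_ubound.
  by exists m, F; split.
Qed.

(** The difference splits as [(mu - mu') K + mu' (K - K')]. The first term is dominated by the image
    of [nu] under [K], the second by [eta], the variation of a difference of two finite images of
    [mu']. *)
Lemma kimage_dominated (mu mu' nu : {measure set T -> \bar R}) :
  mu' setT < +oo -> dominated_diff mu mu' nu ->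
  exists eta : {measure set T -> \bar R}, eta setT <= e%:E * mu' setT /\
    dominated_diff (kimage mu mK) (kimage mu' mK')
      (fun A => kimage nu mK A + eta A).
Proof.
move=> mufin mumu.
have lty (K0 : T -> {measure set T -> \bar R}) (mK0 : forall A, measurable A -> measurable_fun setT (fun y => K0 y A)) :
    (forall y, K0 y setT <= 1) -> kimage mu' mK0 setT < +oo.
  by move=> K01; apply: le_lt_trans mufin; exact: kimage_le.
have [eta [eta1 eta2]] := finite_measures_dominated (lty _ mK K1) (lty _ mK' K1')
  (tv_kimage mufin).
exists eta; split=> // A mA; have [h1 h2] := eta2 A mA; split.
  rewrite addeA addeAC; apply: (@le_trans _ _ (kimage mu' mK A + kimage nu mK A)).
    by apply: dominated_diff_integral => //; exact: mK.
  exact: leeD.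
rewrite addeA; apply: le_trans h2 _; rewrite leeD2r//.
by apply: dominated_diff_integral => //; [exact: dominated_diffC|exact: mK].
Qed.

End kimage_dominated.

Definition is_kernel d (T : measurableType d) (R : realType)
    (Q : T -> set T -> \bar R) (K : T -> {measure set T -> \bar R}) :=
  (forall y A, measurable A -> Q y A = K y A) /\
  (forall A, measurable A -> measurable_fun setT (fun y => K y A)).

(** The two outcomes of one Markov step: [Qd] keeps the state and ages the duration, [Qn] jumps and
    resets the duration to 0. *)
Definition markov_split d (T : measurableType d) (R : realType)
    (Qd Qn : T -> set T -> \bar R) :=
  exists Kd Kn : T -> {measure set T -> \bar R},
    [/\ is_kernel Qd Kd, is_kernel Qn Kn & forall y, Kd y setT + Kn y setT = 1].

Lemma eq_tv d (T : measurableType d) (R : realType) (a b : set T -> \bar R) A :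
  (forall A, measurable A -> a A = b A) -> tv a A = tv b A.
Proof.
move=> ab; rewrite /tv; congr ereal_sup; apply/seteqP; split=> _ [n [F [mF tF UF ->]]];
  by exists n, F; split=> //; apply: eq_bigr => i _; rewrite ab.
Qed.

(** * Comparison of two recursions *)

Section Pi_comparison.
Context d (J : measurableType d) (R : realType) (x : J).

(** The effect of one step on durations: [a] moves from [v] to [v + 1], and all the jumps in [b] are
    collected at duration 0. The guard [v <= l] mirrors the one in [Pi]. *)
Definition shift_step (a : nat -> {measure set J -> \bar R})
    (b : nat -> {measure set J -> \bar R}) (l : nat) (w : nat) :
    {measure set J -> \bar R} :=
  if w is v.+1 then (if (v <= l)%N then a v else mzero) else msum b l.+1.

Lemma shift_step_mass a b l :
  \sum_(w < l.+2) shift_step a b l w setT =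
  \sum_(w < l.+1) (b w setT + a w setT).
Proof.
rewrite big_ord_recl/= /msum big_split/=; congr (_ + _); apply: eq_bigr => i _.
have := ltn_ord i; rewrite ltnS => il; rewrite /= ?add0n il//.
Qed.

Variables Qd Qn Qd' Qn' : nat -> nat -> J -> set J -> \bar R.
Hypothesis Q : forall k w, markov_split (Qd k w) (Qn k w).
Hypothesis Q' : forall k w, markov_split (Qd' k w) (Qn' k w).

Lemma Pi_shift (q q' : nat -> nat -> J -> set J -> \bar R)
    (M : nat -> {measure set J -> \bar R}) l
    (Kd Kn : nat -> J -> {measure set J -> \bar R})
    (hKd : forall w, is_kernel (q l w) (Kd w))
    (hKn : forall w, is_kernel (q' l w) (Kn w)) :
  (forall w A, measurable A -> Pi q q' l w x A = M w A) ->
  forall w A, measurable A -> Pi q q' l.+1 w x A =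
    shift_step (fun w => kimage (M w) (hKd w).2) (fun w => kimage (M w) (hKn w).2) l w A.
Proof.
move=> PM [|v] A mA /=.
  rewrite /msum; apply: eq_bigr => i _; rewrite /kernel_mul.
  rewrite (eq_integral_setfun (m2 := M i)); last by move=> *; exact: PM.
  by apply: eq_integral => y _; rewrite (hKn i).1.
case: ifP => // _; rewrite /kernel_mul.
rewrite (eq_integral_setfun (m2 := M v)); last by move=> *; exact: PM.
by apply: eq_integral => y _; rewrite (hKd v).1.
Qed.

Lemma kimage_mass (m : {measure set J -> \bar R})
    (Kd Kn : J -> {measure set J -> \bar R})
    (mKd : forall A, measurable A -> measurable_fun setT (fun y => Kd y A))
    (mKn : forall A, measurable A -> measurable_fun setT (fun y => Kn y A)) :
  (forall y, Kd y setT + Kn y setT = 1) ->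
  kimage m mKn setT + kimage m mKd setT = m setT.
Proof.
move=> K1; rewrite /kimage -ge0_integralD//; [|exact: mKn|exact: mKd].
under eq_integral do rewrite addeC K1.
by rewrite integral_cst// mul1e.
Qed.

(** Induction on the level. The two images of the old error [N w] together have the mass of [N w]
    ([kimage_mass]), so old errors are not amplified. The step adds at most [e] times the mass of
    [M' w] for each of the two kernels, and these masses sum to 1, whence [2 * e] per step. *)
Lemma Pi_comparison (e : R) L : (0 <= e)%R ->
  (forall k w y, (k < L)%N ->
    tv (fun A => Qd k w y A - Qd' k w y A) setT <= e%:E /\
    tv (fun A => Qn k w y A - Qn' k w y A) setT <= e%:E) ->
  forall l, (l <= L)%N -> exists M M' N : nat -> {measure set J -> \bar R},
    [/\ forall w A, measurable A -> Pi Qd Qn l w x A = M w A,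
        forall w A, measurable A -> Pi Qd' Qn' l w x A = M' w A,
        forall w, dominated_diff (M w) (M' w) (N w),
        \sum_(w < l.+1) M w setT = 1 /\ \sum_(w < l.+1) M' w setT = 1 &
        \sum_(w < l.+1) N w setT <= (l%:R * (2 * e))%:E].
Proof.
move=> e0 hQ; elim=> [|l IH] lL.
  pose D w : {measure set J -> \bar R} := if w is 0%N then \d_x else mzero.
  exists D, D, (fun=> mzero); split.
  - by case.
  - by case.
  - by move=> w A mA; rewrite /= adde0.
  - by rewrite !big_ord_recl !big_ord0 /= adde0 diracT.
  - by rewrite big1// mul0r.
have [M [M' [N [PM PM' MN [M1 M1'] N1]]]] := IH (ltnW lL).
have [Kd /choice[Kn KQ]] := choice (Q l).
have [Kd' /choice[Kn' KQ']] := choice (Q' l).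
have hKd w : is_kernel (Qd l w) (Kd w) by have [] := KQ w.
have hKn w : is_kernel (Qn l w) (Kn w) by have [] := KQ w.
have hKd' w : is_kernel (Qd' l w) (Kd' w) by have [] := KQ' w.
have hKn' w : is_kernel (Qn' l w) (Kn' w) by have [] := KQ' w.
have K1 w y : Kd w y setT + Kn w y setT = 1 by have [_ _] := KQ w.
have K1' w y : Kd' w y setT + Kn' w y setT = 1 by have [_ _] := KQ' w.
have Kdle w y : Kd w y setT <= 1 by rewrite -(K1 w y) leeDl.
have Knle w y : Kn w y setT <= 1 by rewrite -(K1 w y) leeDr.
have Kdle' w y : Kd' w y setT <= 1 by rewrite -(K1' w y) leeDl.
have Knle' w y : Kn' w y setT <= 1 by rewrite -(K1' w y) leeDr.
have tvd w y : tv (fun A => Kd w y A - Kd' w y A) setT <= e%:E.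
  have [h _] := hQ l w y lL; apply: le_trans h.
  by rewrite (eq_tv (b := fun A => Qd l w y A - Qd' l w y A))// => A mA;
    rewrite (hKd w).1// (hKd' w).1.
have tvn w y : tv (fun A => Kn w y A - Kn' w y A) setT <= e%:E.
  have [_ h] := hQ l w y lL; apply: le_trans h.
  by rewrite (eq_tv (b := fun A => Qn l w y A - Qn' l w y A))// => A mA;
    rewrite (hKn w).1// (hKn' w).1.
(* Finiteness of [M' w] follows from the total mass 1 of the level, hence only for [w <= l].
   Truncation makes it hold for every [w], as the applications of [choice] below require. *)
pose M2 (w : nat) : {measure set J -> \bar R} := if (w <= l)%N then M' w else mzero.
pose M3 (w : nat) : {measure set J -> \bar R} := if (w <= l)%N then M w else mzero.
have M2fin w : M2 w setT < +oo.
  rewrite /M2; case: ifPn => [wl|_]; last by rewrite /= ltey.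
  apply: (@le_lt_trans _ _ 1); last by rewrite ltey.
  rewrite -M1' (bigD1 (Ordinal (wl : (w < l.+1)%N)))//= leeDl//; exact: sume_ge0.
have M12 : forall w, dominated_diff (M3 w) (M2 w) (N w).
  move=> w; rewrite /M3 /M2; case: ifPn => _; first exact: MN.
  by move=> A mA; rewrite /= /mzero add0e; split.
have etad w := kimage_dominated (hKd w).2 (hKd' w).2 (Kdle w) (Kdle' w)
  (tvd w) (M2fin w) (M12 w).
have etan w := kimage_dominated (hKn w).2 (hKn' w).2 (Knle w) (Knle' w)
  (tvn w) (M2fin w) (M12 w).
have [ed hed] := choice etad.
have [en hen] := choice etan.
pose Nd w : {measure set J -> \bar R} := measure_add (kimage (N w) (hKd w).2) (ed w).
pose Nn w : {measure set J -> \bar R} := measure_add (kimage (N w) (hKn w).2) (en w).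
exists (shift_step (fun w => kimage (M w) (hKd w).2) (fun w => kimage (M w) (hKn w).2) l),
  (shift_step (fun w => kimage (M' w) (hKd' w).2) (fun w => kimage (M' w) (hKn' w).2) l),
  (shift_step Nd Nn l).
have NdE w A : Nd w A = kimage (N w) (hKd w).2 A + ed w A.
  by rewrite /Nd/= /measure_add/= /msum !big_ord_recl big_ord0 adde0.
have NnE w A : Nn w A = kimage (N w) (hKn w).2 A + en w A.
  by rewrite /Nn/= /measure_add/= /msum !big_ord_recl big_ord0 adde0.
have M3E w : (w <= l)%N -> M3 w = M w by rewrite /M3 => ->.
have M2E w : (w <= l)%N -> M2 w = M' w by rewrite /M2 => ->.
split.
- exact: Pi_shift.
- exact: Pi_shift.
- case=> [A mA|v] /=.
    rewrite /msum -!big_split/=; split; apply: lee_sum => i _;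
    rewrite NnE -M3E ?leq_ord// -M2E ?leq_ord//; by have [] := (hen i).2 A mA.
  case: ifPn => vl; last by move=> A mA; rewrite /= /mzero adde0; split.
  by move=> A mA; rewrite NdE -M3E// -M2E//; exact: (hed v).2 A mA.
- split; rewrite shift_step_mass.
    rewrite -M1; apply: eq_bigr => w _; exact: kimage_mass.
  rewrite -M1'; apply: eq_bigr => w _; exact: kimage_mass.
- rewrite shift_step_mass.
  apply: (@le_trans _ _ (\sum_(w < l.+1) (N w setT + (2 * e)%:E * M' w setT))).
    apply: lee_sum => w _; rewrite NdE NnE -(kimage_mass (N w) (hKd w).2 (hKn w).2 (K1 w)).
    rewrite addeACA; apply: leeD => //.
    have wl : (w <= l)%N by rewrite -ltnS.
    rewrite -M2E//.
    rewrite (_ : (2 * e)%:E = e%:E + e%:E); last by rewrite -EFinD mulrDl mul1r.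
    rewrite ge0_muleDl ?lee_fin//; apply: leeD; [exact: (hen w).1|exact: (hed w).1].
  rewrite big_split/= -ge0_sume_distrr// M1' mule1.
  have -> : (l.+1%:R * (2 * e))%:E = (l%:R * (2 * e))%:E + (2 * e)%:E.
    by rewrite -EFinD -natr1 [in LHS]mulrDl mul1r.
  exact: leeD.
Qed.

End Pi_comparison.

Lemma tv_le_measure d (T : measurableType d) (R : realType)
    (a : set T -> \bar R) (n : {measure set T -> \bar R}) :
  (forall A, measurable A -> `|a A| <= n A) -> tv a setT <= n setT.
Proof.
move=> an; apply: ge_ereal_sup => _ [m [F [mF tF <- ->]]].
by rewrite (measure_bigsetU_ord n xpredT)//; apply: lee_sum => i _; exact: an.
Qed.

(** * Intensity kernels *)

Section jordan_parts.
Context d (T : measurableType d) (R : realType).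
Implicit Type nu : {charge set T -> \bar R}.

Lemma neg_part_fin nu A : measurable A -> neg_part nu A \is a fin_num.
Proof. exact: (fin_num_measure (jordan_neg (hahn_PN nu))). Qed.

Lemma charge_partsE nu A : measurable A -> nu A = pos_part nu A - neg_part nu A.
Proof.
by move=> mA; rewrite (jordan_decomp (hahn_PN nu) mA) /cadd/= cscaleN1.
Qed.

Lemma tv_parts nu A : measurable A -> tv nu A = pos_part nu A + neg_part nu A.
Proof. by move=> mA; rewrite (tvE (hahn_PN nu))//. Qed.

End jordan_parts.

Section intensity_kernels.
Context d (J : measurableType d) (R : realType).
Variables (Lambda : R -> R -> J -> {charge set J -> \bar R}) (gamma0 : R).
Hypothesis singletons : forall x : J, measurable [set x].
Hypothesis HL : intensity_family gamma0 Lambda.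
Variable gamma : R.
Hypothesis gamma_gt0 : (0 < gamma)%R.
Hypothesis gamma0_le : (gamma0 <= gamma)%R.

Let measure_split (m : {measure set J -> \bar R}) y A : measurable A ->
  m A = m (A `&` [set y]) + m (A `\ y).
Proof.
by move=> mA; rewrite addeC; exact: measureDI.
Qed.

Section at_time.
Variables s v : R.
Hypotheses (s0 : (0 <= s)%R) (v0 : (0 <= v)%R).

(** The Jordan parts are not linear in the charge, but here all negative parts live on the point [y]
    and all positive parts off it. Both are therefore restrictions of [Lambda] up to sign, and
    differences of parts are controlled by differences of [Lambda]. *)
Lemma pos_part_off_diag y A : measurable A ->
  pos_part (Lambda s v y) A = Lambda s v y (A `\ y).
Proof.
move=> mA; rewrite charge_partsE; last exact: measurableD.
have -> : neg_part (Lambda s v y) (A `\ y) = 0.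
  apply/eqP; rewrite eq_le measure_ge0 andbT.
  rewrite -(intensity_neg_supp HL y s0 v0); apply: le_measure; rewrite ?inE//.
  - exact: measurableD.
  - exact: measurableC.
rewrite sube0 (measure_split _ y mA).
rewrite [X in X + _](_ : _ = 0) ?add0e//.
apply/eqP; rewrite eq_le measure_ge0 andbT.
rewrite -(intensity_pos_supp HL y s0 v0); apply: le_measure; rewrite ?inE//.
exact: measurableI.
Qed.

Lemma neg_part_diag y A : measurable A ->
  neg_part (Lambda s v y) A = neg_part (Lambda s v y) [set y] * \d_y A.
Proof.
move=> mA; rewrite (measure_split _ y mA).
rewrite [X in _ + X](_ : _ = 0) ?adde0.
  rewrite diracE; case: (boolP (y \in A)); rewrite ?inE ?notin_setE => Ay /=.
    by rewrite mule1; congr (neg_part _ _); apply/seteqP; split=> [z []//|z ->].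
  rewrite mule0 (_ : A `&` _ = set0) ?measure0//.
  by apply/seteqP; split=> // z [Az zy]; apply: Ay; rewrite -zy.
apply/eqP; rewrite eq_le measure_ge0 andbT.
rewrite -(intensity_neg_supp HL y s0 v0); apply: le_measure; rewrite ?inE//.
- exact: measurableD.
- exact: measurableC.
Qed.

Lemma neg_partE y : neg_part (Lambda s v y) [set y] = - Lambda s v y [set y].
Proof.
by rewrite charge_partsE// (intensity_pos_supp HL y s0 v0) sub0e oppeK.
Qed.

Lemma neg_part_bound y : neg_part (Lambda s v y) [set y] <= gamma%:E.
Proof.
apply: (@le_trans _ _ gamma0%:E); last by rewrite lee_fin.
apply: le_trans (intensity_bound HL y s0 v0).
by rewrite tv_parts// (intensity_pos_supp HL y s0 v0) add0e.
Qed.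

Lemma intensity_markov_split :
  markov_split (Qdiag gamma Lambda s v) (Qjump gamma Lambda s v).
Proof.
pose n y := fine (neg_part (Lambda s v y) [set y]).
have nE y : neg_part (Lambda s v y) [set y] = (n y)%:E.
  by rewrite /n fineK// neg_part_fin.
have n0 y : (0 <= n y)%R by rewrite fine_ge0.
have c0 y : (0 <= 1 - gamma^-1 * n y)%R.
  rewrite subr_ge0 mulrC ler_pdivrMr// mul1r -lee_fin -nE; exact: neg_part_bound.
have g0 : (0 <= gamma^-1)%R by rewrite invr_ge0 ltW.
(* The set [[set y]] moves with [y], so [intensity_neg_kernel] does not apply to it directly; it
   applies to the total mass, which is the same number. *)
have nT y : n y = fine (neg_part (Lambda s v y) setT).
  by rewrite /n (neg_part_diag y measurableT) diracT mule1.
have mn : measurable_fun setT n.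
  rewrite (_ : n = fun y => fine (neg_part (Lambda s v y) setT)); last exact/funext.
  apply: measurableT_comp; first exact: fine_measurable.
  exact: (intensity_neg_kernel HL s0 v0 measurableT).
pose Kd y : {measure set J -> \bar R} := mscale (NngNum (c0 y)) \d_y.
pose Kn y : {measure set J -> \bar R} := mscale (NngNum g0) (pos_part (Lambda s v y)).
have KdE y A : Kd y A = (1 - gamma^-1 * n y)%:E * \d_y A by [].
have KnE y A : Kn y A = (gamma^-1)%:E * pos_part (Lambda s v y) A by [].
exists Kd, Kn; split.
- split=> [y A mA|A mA].
    rewrite /Qdiag KdE neg_part_diag// nE muleA -EFinM diracE -!EFinM.
    by congr (_%:E); rewrite mulrBl mul1r.
  under eq_fun do rewrite KdE.
  apply: emeasurable_funM; last exact: measurable_fun_dirac.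
  apply/measurable_EFinP; apply: measurable_funB => //; exact: measurable_funM.
- split=> [y A mA|A mA]; first by rewrite /Qjump KnE.
  under eq_fun do rewrite KnE.
  apply: emeasurable_funM => //; exact: (intensity_pos_kernel HL s0 v0 mA).
- move=> y; rewrite KdE KnE diracT mule1.
  rewrite (measure_split _ y measurableT) setTI setTD (intensity_pos_supp HL y s0 v0).
  rewrite -(intensity_balance HL y s0 v0) add0e nE -EFinM -EFinD.
  by rewrite subrK.
Qed.

End at_time.

(** One measure, [gamma^-1] times the variation [m] of the difference of the intensities, dominates
    both differences: on the diagonal through [m [set y]] when [y] lies in [A], for the jumps
    through [m] of [A] without [y]. *)
Lemma intensity_tv s v s' v' y (e : R) : (0 <= s)%R -> (0 <= v)%R ->
    (0 <= s')%R -> (0 <= v')%R ->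
    tv (fun A => Lambda s v y A - Lambda s' v' y A) setT <= e%:E ->
  tv (fun A => Qdiag gamma Lambda s v y A - Qdiag gamma Lambda s' v' y A) setT
    <= (gamma^-1 * e)%:E /\
  tv (fun A => Qjump gamma Lambda s v y A - Qjump gamma Lambda s' v' y A) setT
    <= (gamma^-1 * e)%:E.
Proof.
move=> s0 v0 s0' v0' tve.
have [m [mT mA]] := charge_dominated (cadd (Lambda s v y) (copp (Lambda s' v' y))).
have {}mA A : measurable A -> `|Lambda s v y A - Lambda s' v' y A| <= m A by exact: mA.
have g0 : (0 <= gamma^-1)%R by rewrite invr_ge0 ltW.
pose k : {measure set J -> \bar R} := mscale (NngNum g0) m.
have kE A : k A = (gamma^-1)%:E * m A by [].
have kT : k setT <= (gamma^-1 * e)%:E.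
  by rewrite kE EFinM lee_pmul2l ?lte_fin ?invr_gt0// mT.
split; apply: le_trans kT; apply: tv_le_measure => A MA; rewrite kE.
- rewrite /Qdiag !(neg_part_diag _ _ _ MA)// !neg_partE//.
  have mAy : m [set y] * \d_y A <= m A.
    rewrite diracE; case: (boolP (y \in A)) => Ay; rewrite ?mule0//= mule1.
    move/set_mem in Ay.
    by apply: le_measure; rewrite ?inE// => z ->.
  rewrite diracE in mAy *.
  have := mA _ (singletons y).
  have : Lambda s' v' y [set y] \is a fin_num by exact: fin_num_measure.
  have : Lambda s v y [set y] \is a fin_num by exact: fin_num_measure.
  case: (Lambda s v y [set y]) => // a _; case: (Lambda s' v' y [set y]) => // b _.
  move=> mab /=.
  set t : R := (y \in A)%:R in mAy *.
  apply: (@le_trans _ _ ((gamma^-1)%:E * (m [set y] * t%:E))); last first.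
    by apply: lee_wpmul2l; rewrite ?lee_fin.
  rewrite muleA.
  have -> : `|t - gamma^-1 * (- a * t) - (t - gamma^-1 * (- b * t))|%R =
            (gamma^-1 * `|a - b| * t)%R.
    rewrite -[in RHS](ger0_norm g0) -normrM -[in RHS](@ger0_norm _ t) ?ler0n// -normrM.
    congr (`|_|)%R; ring.
  rewrite EFinM lee_wpmul2r ?lee_fin ?ler0n// EFinM lee_wpmul2l ?lee_fin//.
- rewrite /Qjump !pos_part_off_diag//.
  have MAy : measurable (A `\ y) by exact: measurableD.
  apply: (@le_trans _ _ ((gamma^-1)%:E * m (A `\ y))); last first.
    by apply: lee_wpmul2l; rewrite ?lee_fin//; apply: le_measure; rewrite ?inE// => z [].
  have := mA _ MAy.
  have : Lambda s' v' y (A `\ y) \is a fin_num by exact: fin_num_measure.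
  have : Lambda s v y (A `\ y) \is a fin_num by exact: fin_num_measure.
  case: (Lambda s v y _) => // a _; case: (Lambda s' v' y _) => // b _ ab.
  rewrite (_ : `|_| = (gamma^-1 * `|a - b|)%:E); last first.
    by rewrite /= -mulrBr normrM (ger0_norm g0).
  by rewrite EFinM lee_wpmul2l ?lee_fin.
Qed.

End intensity_kernels.

(** * The recursion driven by two sequences of arrival times *)

Definition valid_arrivals (R : realType) (chi : nat -> R) :=
  (forall n, 0 <= chi n)%R /\ (forall m n, (m <= n)%N -> chi m <= chi n)%R.

Definition close_families d (J : measurableType d) (R : realType) (x : J)
    (PI PI' : nat -> nat -> J -> set J -> \bar R)
    (M M' N : nat -> nat -> {measure set J -> \bar R}) (D : nat -> R) :=
  [/\ forall l w A, measurable A -> PI l w x A = M l w A,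
      forall l w A, measurable A -> PI' l w x A = M' l w A,
      forall l w, dominated_diff (M l w) (M' l w) (N l w),
      forall l, \sum_(w < l.+1) M l w setT = 1 /\ \sum_(w < l.+1) M' l w setT = 1 &
      forall l, \sum_(w < l.+1) N l w setT <= (D l)%:E].

Lemma tv_self d (T : measurableType d) (R : realType) (a : set T -> \bar R) :
  (forall A, measurable A -> a A \is a fin_num) ->
  tv (fun A => a A - a A) setT <= 0.
Proof.
move=> af; apply: ge_ereal_sup => _ [m [F [mF tF UF ->]]].
by rewrite big1// => i _; rewrite subee ?abse0//; exact: af.
Qed.

Lemma markov_split_fin d (T : measurableType d) (R : realType)
    (Qd Qn : T -> set T -> \bar R) : markov_split Qd Qn ->
  forall y A, measurable A -> Qd y A \is a fin_num /\ Qn y A \is a fin_num.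
Proof.
move=> [Kd [Kn [hd hn K1]]] y A mA; rewrite hd.1// hn.1//.
have := K1 y; split; rewrite ge0_fin_numE//; apply: (@le_lt_trans _ _ 1);
  rewrite ?ltey// -(K1 y).
  by apply: (@le_trans _ _ (Kd y setT)); rewrite ?leeDl//; apply: le_measure; rewrite ?inE.
by apply: (@le_trans _ _ (Kn y setT)); rewrite ?leeDr//; apply: le_measure; rewrite ?inE.
Qed.

Section Pi_hat.
Context d (J : measurableType d) (R : realType).
Variables (Lambda : R -> R -> J -> {charge set J -> \bar R}) (gamma0 : R).
Hypothesis singletons : forall x : J, measurable [set x].
Hypothesis HL : intensity_family gamma0 Lambda.
Variable gamma : R.
Hypothesis gamma_gt0 : (0 < gamma)%R.
Hypothesis gamma0_le : (gamma0 <= gamma)%R.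
Variable K : R.
Hypothesis K0 : (0 < K)%R.
Hypothesis lipK : forall (x : J) (s1 s2 v1 v2 : R), (0 <= s1)%R -> (0 <= s2)%R ->
  (0 <= v1)%R -> (0 <= v2)%R ->
  tv (fun A => Lambda s1 v1 x A - Lambda s2 v2 x A) setT
    <= (K * (`|s1 - s2| + `|v1 - v2|))%:E.

(* Up to step [L] each step costs [2 * (K * 3 r / gamma)]; after step [L] the
   trivial bound [2] on the total variation is relaxed to [2 * e ^ (l - L)], whose
   Poisson average is explicit. *)
Definition Pi_bound (L : nat) (r : R) (l : nat) : R :=
  (L%:R * (2 * (gamma^-1 * (K * (3 * r)))) + 2 * expR (l%:R - L%:R))%R.

Lemma Pi_hat_close (chi chi' : nat -> R) (L : nat) (r : R) (x : J) :
  valid_arrivals chi -> valid_arrivals chi' -> (0 <= r)%R ->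
  (forall k, (k <= L)%N -> `|chi k - chi' k| <= r)%R ->
  exists M M' N, close_families x (Pi_hat gamma Lambda chi)
    (Pi_hat gamma Lambda chi') M M' N (Pi_bound L r).
Proof.
move=> [c0 cm] [c0' cm'] r0 hr.
set e := (gamma^-1 * (K * (3 * r)))%R.
have g0 : (0 <= gamma^-1)%R by rewrite invr_ge0 ltW.
have e0 : (0 <= e)%R by rewrite !mulr_ge0// ltW.
pose S k := chi k.+1; pose V k w := (chi k.+1 - chi (k - w)%N)%R.
pose S' k := chi' k.+1; pose V' k w := (chi' k.+1 - chi' (k - w)%N)%R.
have kw k w : (k - w <= k.+1)%N by rewrite (leq_trans (leq_subr _ _)).
have V0 k w : (0 <= V k w)%R by rewrite subr_ge0; exact: cm.
have V0' k w : (0 <= V' k w)%R by rewrite subr_ge0; exact: cm'.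
pose Qd k w := Qdiag gamma Lambda (S k) (V k w).
pose Qn k w := Qjump gamma Lambda (S k) (V k w).
pose Qd' k w := Qdiag gamma Lambda (S' k) (V' k w).
pose Qn' k w := Qjump gamma Lambda (S' k) (V' k w).
have ms k w : markov_split (Qd k w) (Qn k w).
  exact: (intensity_markov_split singletons HL gamma_gt0 gamma0_le (c0 k.+1) (V0 k w)).
have ms' k w : markov_split (Qd' k w) (Qn' k w).
  exact: (intensity_markov_split singletons HL gamma_gt0 gamma0_le (c0' k.+1) (V0' k w)).
have tvQ k w y : (k < L)%N ->
    tv (fun A => Qd k w y A - Qd' k w y A) setT <= e%:E /\
    tv (fun A => Qn k w y A - Qn' k w y A) setT <= e%:E.
  move=> kL; apply: (intensity_tv singletons HL) => //; [exact: c0|exact: c0'|].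
  apply: le_trans (lipK _ (c0 k.+1) (c0' k.+1) (V0 k w) (V0' k w)) _.
  rewrite lee_fin ler_pM2l//.
  have h1 := hr _ kL; have h2 := hr (k - w)%N (leq_trans (kw _ _) kL).
  (* A duration is a difference of two arrival times, hence off by at most [2 r]; together with the
     [r] from the time itself this is the factor 3 in [e]. *)
  have h3 : (`|V k w - V' k w| <= `|chi k.+1 - chi' k.+1| + `|chi (k - w)%N - chi' (k - w)%N|)%R.
    rewrite (_ : V k w - V' k w = (chi k.+1 - chi' k.+1) - (chi (k - w)%N - chi' (k - w)%N))%R.
      exact: ler_normB.
    rewrite /V /V'; ring.
  rewrite /S /S'; lra.
suff /choice[M /choice[M' /choice[N h]]] : forall l, exists M M' N : nat -> {measure set J -> \bar R},
    [/\ forall w A, measurable A -> Pi Qd Qn l w x A = M w A,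
        forall w A, measurable A -> Pi Qd' Qn' l w x A = M' w A,
        forall w, dominated_diff (M w) (M' w) (N w),
        \sum_(w < l.+1) M w setT = 1 /\ \sum_(w < l.+1) M' w setT = 1 &
        \sum_(w < l.+1) N w setT <= (Pi_bound L r l)%:E].
  exists M, M', N; split=> l; by have [] := h l.
move=> l; have [lL|Ll] := leqP l L.
  have [M [M' [N [h1 h2 h3 h4 h5]]]] := Pi_comparison x ms ms' e0 tvQ lL.
  exists M, M', N; split=> //; apply: le_trans h5 _; rewrite lee_fin.
  apply: (@le_trans _ _ (L%:R * (2 * e)))%R; last by rewrite lerDl mulr_ge0// expR_ge0.
  by apply: ler_wpM2r; [rewrite mulr_ge0|rewrite ler_nat].
(* Beyond [L] each recursion is compared with itself, only to obtain its terms as measures of total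
   mass 1 per level. Then [M + M'] dominates the difference, with mass 2. *)
have tv0 (q q' : nat -> nat -> J -> set J -> \bar R) :
    (forall k w, markov_split (q k w) (q' k w)) ->
    forall k w y, (k < l)%N ->
      tv (fun A => q k w y A - q k w y A) setT <= 0%:E /\
      tv (fun A => q' k w y A - q' k w y A) setT <= 0%:E.
  by move=> h k w y _; split; apply: tv_self => A mA; have [] := markov_split_fin (h k w) y mA.
have [M [_ [_ [h1 _ _ [h2 _] _]]]] := Pi_comparison x ms ms (lexx _) (tv0 _ _ ms) (leqnn l).
have [M' [_ [_ [h1' _ _ [h2' _] _]]]] := Pi_comparison x ms' ms' (lexx _) (tv0 _ _ ms') (leqnn l).
pose N w : {measure set J -> \bar R} := measure_add (M w) (M' w).
have NE w A : N w A = M w A + M' w A.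
  by rewrite /N/= /measure_add/= /msum !big_ord_recl big_ord0 adde0.
exists M, M', N; split=> //.
  move=> w A mA; rewrite NE; split; first by rewrite addeCA leeDl// adde_ge0.
  by rewrite addeA leeDr// adde_ge0.
under eq_bigr do rewrite NE.
rewrite big_split/= h2 h2' -EFinD lee_fin /Pi_bound -/e.
have -> : (1 + 1 = 2 * 1 :> R)%R by rewrite mulr1.
apply: (@le_trans _ _ (2 * expR (l%:R - L%:R)))%R; last by rewrite lerDr mulr_ge0// mulr_ge0.
apply: ler_wpM2l => //.
by rewrite -[X in (X <= _)%R]expR0 ler_expR subr_ge0 ler_nat ltnW.
Qed.

End Pi_hat.

(** * Poisson and Erlang weights *)

Lemma nneseries_exp (R : realType) (x : R) : (0 <= x)%R ->
  \sum_(0 <= k <oo) (x ^+ k / k`!%:R)%:E = (expR x)%:E.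
Proof.
move=> x0; rewrite expRE -EFin_lim; last first.
  rewrite /pseries/=; under eq_fun do rewrite mulrC.
  exact: is_cvg_series_exp_coeff.
apply/congr_lim/funext => n/=; rewrite /pseries/= /series/= -sumEFin//.
by under eq_bigr do rewrite mulrC.
Qed.

Lemma Poi_ge0 (R : realType) (x : R) k : (0 <= x)%R -> (0 <= Poi x k)%R.
Proof. by move=> x0; rewrite /Poi !mulr_ge0 ?expR_ge0 ?exprn_ge0 ?invr_ge0. Qed.

(** The moment generating function of the Poisson law: [t = 0] gives the total mass, and [t = 1]
    averages the exponential term of [Pi_bound]. *)
Lemma nneseries_Poi_expR (R : realType) (x t : R) : (0 <= x)%R ->
  \sum_(0 <= k <oo) (Poi x k * expR (t * k%:R))%:E = (expR (x * (expR t - 1)))%:E.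
Proof.
move=> x0; have xe0 : (0 <= x * expR t)%R by rewrite mulr_ge0// expR_ge0.
transitivity (\sum_(0 <= k <oo) ((expR (- x))%:E * ((x * expR t) ^+ k / k`!%:R)%:E)).
  apply: eq_eseriesr => k _; rewrite -EFinM; congr (_%:E).
  by rewrite /Poi [(t * _)%R]mulrC expRM_natl exprMn; ring.
rewrite nneseriesZl; last by move=> k _; rewrite lee_fin divr_ge0// exprn_ge0.
by rewrite nneseries_exp// -EFinM -expRD; congr (expR _)%:E; ring.
Qed.

Lemma nneseries_Poi (R : realType) (x : R) : (0 <= x)%R ->
  \sum_(0 <= k <oo) (Poi x k)%:E = 1.
Proof.
move=> x0; have := nneseries_Poi_expR 0 x0; rewrite expR0 subrr mulr0 expR0 => <-.
by apply: eq_eseriesr => k _; rewrite mul0r expR0 mulr1.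
Qed.

Lemma Poi_add (R : realType) (x y : R) n :
  (\sum_(i < n.+1) Poi x (n - i) * Poi y i = Poi (x + y) n)%R.
Proof.
rewrite /Poi exprDn opprD expRD mulr_sumr mulr_suml; apply: eq_bigr => i _.
have ni : (i <= n)%N by rewrite -ltnS.
have f0 k : (k`!%:R != 0 :> R)%R by rewrite pnatr_eq0 -lt0n fact_gt0.
have /(congr1 (fun k => k%:R : R)%R) := bin_fact ni.
rewrite !natrM -mulr_natr => <-.
have b0 : ('C(n, i)%:R != 0 :> R)%R by rewrite pnatr_eq0 -lt0n bin_gt0.
by field; rewrite !f0 b0.
Qed.

Lemma esum_pairs_lt (R : realType) (f : nat -> nat -> \bar R) :
  (forall l w, 0 <= f l w) ->
  \esum_(lw in [set lw : nat * nat | (lw.2 < lw.1)%N]) f lw.1 lw.2 =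
  \sum_(0 <= l <oo) \sum_(w < l) f l w.
Proof.
move=> f0; rewrite nneseries_esumT; last by move=> l; exact: sume_ge0.
rewrite (_ : [set lw | _] = setT `*`` (fun l => `I_l)); last first.
  by apply/seteqP; split=> -[l w] //= [].
rewrite -(esum_esum (a := f))//; apply: eq_esum => l _.
by rewrite esum_fset// fsbig_ord.
Qed.

Section mixture.
Context d (J : measurableType d) (R : realType).
Implicit Types (c : nat -> nat -> R) (M : nat -> nat -> set J -> \bar R).

(** The common form of [p_a] and [p_c]: the weights [c] sit on [w = l] for the former and on [w < l]
    for the latter, so that one estimate serves both. *)
Definition mixture c M (U : set J) : \bar R :=
  \sum_(0 <= l <oo) \sum_(w < l.+1) (c l w)%:E * M l w U.

Lemma mixture_term_ge0 c (M : nat -> nat -> {measure set J -> \bar R}) U l :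
  (forall l w, 0 <= c l w)%R -> 0 <= \sum_(w < l.+1) (c l w)%:E * M l w U.
Proof. by move=> c0; apply: sume_ge0 => w _; rewrite mule_ge0 ?lee_fin. Qed.

Lemma eq_mixture c M M' U : (forall l w, M l w U = M' l w U) ->
  mixture c M U = mixture c M' U.
Proof.
by move=> h; apply: eq_eseriesr => l _; apply: eq_bigr => w _; rewrite h.
Qed.

Lemma mixture_fin c (M : nat -> nat -> {measure set J -> \bar R}) U :
  (forall l w, 0 <= c l w)%R ->
  \sum_(0 <= l <oo) \sum_(w < l.+1) (c l w)%:E < +oo ->
  (forall l w, (w <= l)%N -> M l w setT <= 1) -> measurable U ->
  mixture c M U \is a fin_num.
Proof.
move=> c0 cfin M1 mU; rewrite ge0_fin_numE; last first.
  by apply: nneseries_ge0 => l _ _; exact: mixture_term_ge0.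
apply: le_lt_trans cfin; apply: lee_nneseries.
  by move=> l _ _; exact: mixture_term_ge0.
move=> l _; apply: lee_sum => w _.
rewrite -[leRHS]mule1; apply: lee_wpmul2l; first by rewrite lee_fin.
by apply: le_trans (M1 l w _); [apply: le_measure; rewrite ?inE|rewrite -ltnS].
Qed.

(** On each cell of a partition the two mixtures differ by at most the mixture of the [N l w], which
    is additive and so sums to its total mass over the cells. *)
Lemma tv_mixture_le c (M M' N : nat -> nat -> {measure set J -> \bar R})
    (g : set J -> \bar R) :
  (forall l w, 0 <= c l w)%R ->
  \sum_(0 <= l <oo) \sum_(w < l.+1) (c l w)%:E < +oo ->
  (forall l w, (w <= l)%N -> M l w setT <= 1) ->
  (forall l w, (w <= l)%N -> M' l w setT <= 1) ->
  (forall l w, dominated_diff (M l w) (M' l w) (N l w)) ->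
  (forall U, measurable U -> g U \is a fin_num) ->
  tv (fun U => mixture c M U - g U) setT <=
  tv (fun U => mixture c M' U - g U) setT + mixture c N setT.
Proof.
move=> c0 cfin M1 M1' MN gf.
apply: ge_ereal_sup => _ [m [F [mF tF UF ->]]].
have term0 (P : nat -> nat -> {measure set J -> \bar R}) U l :=
  mixture_term_ge0 P U l c0.
have mono (P P' : nat -> nat -> {measure set J -> \bar R}) U :
    (forall l w, P l w U <= P' l w U + N l w U) ->
    mixture c P U <= mixture c P' U + mixture c N U.
  move=> h; rewrite /mixture -nneseriesD//; try by move=> *; exact: term0.
  apply: lee_nneseries => [*|l _]; first exact: term0.
  rewrite -big_split/=; apply: lee_sum => w _.
  rewrite -ge0_muleDr//; apply: lee_wpmul2l => //; by rewrite lee_fin.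
apply: (@le_trans _ _ (\sum_(i < m) (`|mixture c M' (F i) - g (F i)| + mixture c N (F i)))).
  apply: lee_sum => i _.
  have h1 := mono M M' (F i) (fun l w => (MN l w _ (mF i)).1).
  have h2 := mono M' M (F i) (fun l w => (MN l w _ (mF i)).2).
  move: h1 h2 (gf _ (mF i)) (mixture_fin c0 cfin M1 (mF i)) (mixture_fin c0 cfin M1' (mF i)).
  have : 0 <= mixture c N (F i) by apply: nneseries_ge0 => *; exact: term0.
  case: (mixture c N (F i)) => [n| |] //; last first.
    by move=> _ _ _ _ _ _; rewrite addey ?leey// gt_eqF// (lt_le_trans _ (abse_ge0 _)).
  move=> _ + + + + +.
  case: (mixture c M (F i)) => // a; case: (mixture c M' (F i)) => // b.
  case: (g (F i)) => // z; rewrite -!EFinD !lee_fin /= => h1 h2 _ _ _.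
  have -> : (a - z = (b - z) + (a - b))%R by ring.
  apply: le_trans (ler_normD _ _) _; rewrite lerD2l ler_norml; apply/andP; split; lra.
rewrite big_split/=; apply: leeD.
  by apply: ereal_sup_ubound; exists m, F; split.
rewrite /mixture -nneseries_sum; last by move=> *; exact: term0.
apply: lee_nneseries => [*|l _]; first by apply: sume_ge0 => *; exact: term0.
rewrite exchange_big/=; apply: lee_sum => w _.
by rewrite -ge0_sume_distrr// -UF (measure_bigsetU_ord (N l w) xpredT).
Qed.

End mixture.

Local Close Scope ereal_scope.

Section beta_integral.
Context (R : realType).
Implicit Types (s t : R) (n w : nat).

Definition pow_fact n : R -> R := fun t => t ^+ n / n`!%:R.

Lemma is_derive_pow_fact n t : is_derive t 1 (pow_fact n.+1) (pow_fact n t).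
Proof.
have -> : pow_fact n.+1 = ((n.+1)`!%:R^-1 : R) *: (@id R ^+ n.+1).
  by apply/funext => x; rewrite /pow_fact [LHS]mulrC -[in LHS]/(_ *: _) fctE.
apply: is_derive_eq; rewrite /pow_fact /GRing.scale/= mulr1.
have f0 k : (k`!%:R != 0 :> R) by rewrite pnatr_eq0 -lt0n fact_gt0.
rewrite factS natrM; field.
by rewrite f0 addrC natr1 pnatr_eq0.
Qed.

Definition beta_integrand s n w t := pow_fact n (s - t) * pow_fact w t.

(* With [B n w := beta_integrand s n w], the derivative of [B n.+1 w.+1] is
   [B n.+1 w - B n w.+1]; hence this telescoping primitive of [B n w]. *)
Fixpoint beta_primitive s n w : R -> R :=
  if n is m.+1 then fun t => beta_integrand s m.+1 w.+1 t + beta_primitive s m w.+1 t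
  else pow_fact w.+1.

Lemma is_derive_beta_primitive s n w t :
  is_derive t 1 (beta_primitive s n w) (beta_integrand s n w t).
Proof.
elim: n w => [|n IH] w /=.
  apply: (is_derive_eq (is_derive_pow_fact w t)).
  by rewrite /beta_integrand {2}/pow_fact expr0 fact0 divr1 mul1r.
have d1 : is_derive t 1 (fun t => pow_fact n.+1 (s - t)) (- pow_fact n (s - t)).
  have ds : is_derive t 1 (fun t : R => s - t) (- 1).
    by apply: is_derive_eq; rewrite add0r mul1r.
  have := @is_derive1_comp R (pow_fact n.+1) (fun t => s - t) t _ _ (is_derive_pow_fact n (s - t)) ds.
  by rewrite mulrN1.
have d2 := is_derive_pow_fact w t.
have dm : is_derive t 1 (beta_integrand s n.+1 w.+1)
    (beta_integrand s n.+1 w t - beta_integrand s n w.+1 t).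
  have -> : beta_integrand s n.+1 w.+1 = (fun t => pow_fact n.+1 (s - t)) * pow_fact w.+1.
    by [].
  apply: (is_derive_eq (is_deriveM d1 d2)).
  by rewrite /beta_integrand /GRing.scale/=; ring.
apply: (is_derive_eq (is_deriveD dm (IH w.+1))).
by rewrite subrK.
Qed.

Lemma beta_primitive0 s n w : beta_primitive s n w 0 = 0.
Proof.
elim: n w => [|n IH] w /=; first by rewrite /pow_fact expr0n mul0r.
by rewrite IH addr0 /beta_integrand /pow_fact [0 ^+ w.+1]expr0n mul0r mulr0.
Qed.

(** At [t = s] every term with a positive power of [s - t] vanishes, and only the last term of the
    telescoping sum remains. *)
Lemma beta_primitiveT s n w : beta_primitive s n w s = pow_fact (n + w).+1 s.
Proof.
elim: n w => [|n IH] w //=.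
by rewrite IH addnS addSn /beta_integrand subrr /pow_fact expr0n !mul0r add0r.
Qed.

Lemma continuous_beta_integrand s n w : continuous (beta_integrand s n w).
Proof.
move=> t; apply: cvgM; apply: cvgM; try exact: cvg_cst.
  by apply: (@continuous_comp _ _ _ (fun t => s - t) (fun x => x ^+ n));
    [apply: cvgB; [exact: cvg_cst|exact: cvg_id]|exact: exprn_continuous].
exact: exprn_continuous.
Qed.

Lemma integral_beta_integrand s n w : 0 < s ->
  (\int[lebesgue_measure]_(t in `[0%R, s]) (beta_integrand s n w t)%:E
   = (pow_fact (n + w).+1 s)%:E)%E.
Proof.
move=> s0; rewrite (@continuous_FTC2 _ _ (beta_primitive s n w))//.
- by rewrite beta_primitiveT beta_primitive0 sube0.
- by apply: continuous_subspaceT; exact: continuous_beta_integrand.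
- have cont t : {for t, continuous (beta_primitive s n w)}.
    apply: differentiable_continuous; apply/derivable1_diffP.
    by have [] := is_derive_beta_primitive s n w t.
  split.
  + by move=> t _; have [] := is_derive_beta_primitive s n w t.
  + exact/cvg_at_right_filter/cont.
  + exact/cvg_at_left_filter/cont.
- move=> t _; rewrite derive1E.
  by have [_ ->] := is_derive_beta_primitive s n w t.
Qed.

(** The two exponentials merge into one that does not depend on [t], which leaves a polynomial to
    integrate. *)
Lemma Erl_PoiE gamma s t n w : 0 <= gamma ->
  Erl n.+1 gamma (s - t) * Poi (gamma * t) w =
  gamma ^+ (n + w).+1 * expR (- (gamma * s)) * beta_integrand s n w t.
Proof.
move=> g0; rewrite /Erl /Poi /beta_integrand /pow_fact /= !exprMn exprS exprD.
have -> : expR (- (gamma * s)) = expR (- (gamma * (s - t))) * expR (- (gamma * t)).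
  by rewrite -expRD; congr expR; ring.
have f0 k : (k`!%:R != 0 :> R) by rewrite pnatr_eq0 -lt0n fact_gt0.
by field; rewrite !f0.
Qed.

Lemma integral_Erl_Poi gamma s v n w : 0 < gamma -> 0 <= v <= s ->
  (\int[lebesgue_measure]_(t in `[0%R, v])
     (Erl n.+1 gamma (s - t) * Poi (gamma * t) w)%:E
   <= (Poi (gamma * s) (n + w).+1)%:E)%E.
Proof.
move=> g0 /andP[v0 vs].
have P0 : 0 <= Poi (gamma * s) (n + w).+1.
  by apply/Poi_ge0/mulr_ge0; [exact: ltW|exact: le_trans vs].
have [->|vn0] := eqVneq v 0; first by rewrite set_itv1 integral_set1 lee_fin.
have s0 : 0 < s by apply: lt_le_trans vs; rewrite lt_neqAle eq_sym vn0.
have c0 : 0 <= gamma ^+ (n + w).+1 * expR (- (gamma * s)).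
  by rewrite mulr_ge0 ?expR_ge0// exprn_ge0// ltW.
have b0 t : `[0%R, s]%classic t -> 0 <= beta_integrand s n w t.
  rewrite /= in_itv/= => /andP[t0 ts].
  by apply: mulr_ge0; apply: divr_ge0; rewrite ?ler0n// exprn_ge0// subr_ge0.
have mb : measurable_fun setT (beta_integrand s n w).
  by apply: continuous_measurable_fun; exact: continuous_beta_integrand.
(* Enlarging the domain from [v] to [s] completes the beta integral, whose value is exactly the
   Poisson weight. *)
apply: (@le_trans _ _ (\int[lebesgue_measure]_(t in `[0%R, s])
    (gamma ^+ (n + w).+1 * expR (- (gamma * s)) * beta_integrand s n w t)%:E)%E).
  under eq_integral do rewrite Erl_PoiE ?ltW//.
  apply: ge0_subset_integral => //.
  - by apply/measurable_EFinP/measurable_funM => //; exact: measurable_funTS.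
  - by move=> t ts; rewrite lee_fin mulr_ge0// b0.
  - by move=> t /=; rewrite !in_itv/= => /andP[-> /le_trans->].
under eq_integral do rewrite EFinM.
rewrite ge0_integralZl//; last by apply/measurable_EFinP; exact: measurable_funTS.
rewrite integral_beta_integrand// -EFinM lee_fin /Poi /pow_fact.
by rewrite exprMn [leLHS](_ : _ = expR (- (gamma * s)) *
  (gamma ^+ (n + w).+1 * s ^+ (n + w).+1) / (n + w).+1`!%:R)//; ring.
Qed.

End beta_integral.

Local Open Scope ereal_scope.

Lemma tv_ge0 d (T : measurableType d) (R : realType) (nu : set T -> \bar R) :
  0 <= tv nu setT.
Proof.
apply: (@le_trans _ _ `|nu setT|) => //; apply: ereal_sup_ubound.
exists 1%N, (fun=> setT); split=> //; last 2 first.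
- by rewrite big_ord1.
- by rewrite big_ord1.
by apply/trivIsetP => i j _ _; rewrite !ord1 eqxx.
Qed.

(* [f] and [g] need not be measurable: this spares the measurability in [v'] of
   the total variation of [p_c]. *)
Lemma ge0_integral_lowerD d (T : measurableType d) (R : realType)
    (mu : {measure set T -> \bar R}) (D : set T) (f g h : T -> \bar R) :
  measurable D -> measurable_fun D h ->
  (forall x, D x -> 0 <= f x) -> (forall x, D x -> 0 <= g x) ->
  (forall x, D x -> 0 <= h x) -> (forall x, D x -> f x <= g x + h x) ->
  \int[mu]_(x in D) f x <= \int[mu]_(x in D) g x + \int[mu]_(x in D) h x.
Proof.
move=> mD mh f0 g0 h0 fgh.
have r0 (k : T -> \bar R) : (forall x, D x -> 0 <= k x) -> forall x, 0 <= (k \_ D) x.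
  by move=> k0 x; rewrite patchE; case: ifPn => // /set_mem; exact: k0.
have mhD : measurable_fun setT (h \_ D) by apply/(measurable_restrictT _ _).1.
rewrite integral_mkcond (integral_mkcond D g) (integral_mkcond D h).
rewrite {1}ge0_integralTE; last exact: r0.
apply: ge_ereal_sup => _ [k kf <-].
have -> : sintegral mu k = \int[mu]_x (k x)%:E.
  by rewrite integral_nnsfun// patch_setT.
(* For a simple [k] below [f], the function [kg] is measurable, lies below [g], and satisfies
   [k <= kg + h]. Additivity of the integral is thus needed only for the measurable pair [kg],
   [h]. *)
pose kg x := maxe ((k x)%:E - (h \_ D) x) 0.
have kg0 x : 0 <= kg x by rewrite /kg le_max lexx orbT.
have mk : measurable_fun setT (fun x => (k x)%:E) by apply/measurable_EFinP.
have mkg : measurable_fun setT kg.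
  by apply: measurable_maxe => //; exact: emeasurable_funB.
apply: (@le_trans _ _ (\int[mu]_x (kg x + (h \_ D) x))).
  apply: ge0_le_integral => //.
  - by move=> x _; rewrite lee_fin.
  - exact: emeasurable_funD.
  - move=> x _; have := kg0 x; rewrite /kg; have := r0 _ h0 x.
    case: ((h \_ D) x) => [y| |] // y0 kgx.
      by rewrite -leeBlDr// le_max lexx.
    by rewrite addey ?leey// gt_eqF// (lt_le_trans _ kgx).
rewrite ge0_integralD//; [|by move=> x _; exact: r0].
apply: leeD => //; apply: ge0_le_integral_lower => x _ //.
rewrite /kg ge_max r0// andbT.
have := kf x; have := r0 _ h0 x; have := r0 _ g0 x; have := r0 _ f0 x.
rewrite !patchE; case: ifPn => [/set_mem xD|_] _ ga ha ka; last by rewrite sube0.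
case: (h x) (fgh _ xD) ha => [y| |] fy // ha; last by rewrite /= leNye.
by rewrite leeBlDr//; exact: le_trans fy.
Qed.

Section mixtures.
Context d (J : measurableType d) (R : realType).

Definition weight_a (gamma s : R) (l w : nat) : R :=
  (if w == l then Poi (gamma * s) l else 0)%R.

Definition weight_c (gamma s v : R) (l w : nat) : R :=
  (if (w < l)%N then Erl (l - w) gamma (s - v) * Poi (gamma * v) w else 0)%R.

Lemma weight_a_ge0 gamma s l w : (0 <= gamma)%R -> (0 <= s)%R -> (0 <= weight_a gamma s l w)%R.
Proof. by move=> g0 s0; rewrite /weight_a; case: ifP => // _; rewrite Poi_ge0 ?mulr_ge0. Qed.

Lemma Erl_ge0 gamma t l : (0 <= gamma)%R -> (0 <= t)%R -> (0 <= Erl l gamma t :> R)%R.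
Proof.
by move=> g0 t0; rewrite /Erl !mulr_ge0 ?expR_ge0 ?exprn_ge0 ?invr_ge0 ?mulr_ge0.
Qed.

Lemma weight_c_ge0 gamma s v l w : (0 <= gamma)%R -> (0 <= v <= s)%R ->
  (0 <= weight_c gamma s v l w)%R.
Proof.
move=> g0 /andP[v0 vs]; rewrite /weight_c; case: ifP => // _.
by rewrite mulr_ge0 ?Erl_ge0 ?Poi_ge0 ?mulr_ge0// subr_ge0.
Qed.

Lemma sum_weight_a (f : nat -> \bar R) gamma s l :
  \sum_(w < l.+1) (weight_a gamma s l w)%:E * f w = (Poi (gamma * s) l)%:E * f l.
Proof.
rewrite big_ord_recr/= /weight_a eqxx big1 ?add0e// => i _.
by rewrite ltn_eqF//= mul0e.
Qed.

Lemma sum_weight_c (f : nat -> \bar R) gamma s v l :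
  \sum_(w < l.+1) (weight_c gamma s v l w)%:E * f w =
  \sum_(w < l) (Erl (l - w) gamma (s - v) * Poi (gamma * v) w)%:E * f w.
Proof.
rewrite big_ord_recr/= /weight_c ltnn mul0e adde0.
by apply: eq_bigr => i _; rewrite ltn_ord.
Qed.

Lemma weight_a_summable gamma s : (0 <= gamma)%R -> (0 <= s)%R ->
  \sum_(0 <= l <oo) \sum_(w < l.+1) (weight_a gamma s l w)%:E < +oo.
Proof.
move=> g0 s0; rewrite (eq_eseriesr (g := fun l => (Poi (gamma * s) l)%:E)).
  by rewrite nneseries_Poi ?mulr_ge0// ltey.
move=> l _; rewrite -[RHS]mule1 -(sum_weight_a (fun=> 1)).
by apply: eq_bigr => w _; rewrite mule1.
Qed.

Lemma weight_c_summable gamma s v : (0 <= gamma)%R -> (0 <= v <= s)%R ->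
  \sum_(0 <= l <oo) \sum_(w < l.+1) (weight_c gamma s v l w)%:E < +oo.
Proof.
move=> g0 vs; have /andP[v0 vs'] := vs.
have s0 : (0 <= s)%R by exact: le_trans vs'.
(* The Erlang density of index [n + 1 - w] is [gamma] times a Poisson weight at [n - w], so the
   level sum is a convolution of Poisson weights ([Poi_add]). *)
have E n : \sum_(w < n.+2) (weight_c gamma s v n.+1 w)%:E = (gamma * Poi (gamma * s) n)%:E.
  transitivity (\sum_(w < n.+2) (weight_c gamma s v n.+1 w)%:E * (1 : \bar R)).
    by apply: eq_bigr => w _; rewrite mule1.
  rewrite (sum_weight_c (fun=> 1)).
  have -> : (gamma * s = gamma * (s - v) + gamma * v)%R by ring.
  rewrite -Poi_add mulr_sumr -sumEFin; apply: eq_bigr => w _; rewrite mule1.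
  have wn : (w <= n)%N by rewrite -ltnS.
  by congr (_%:E); rewrite subSn// /Erl /Poi/=; ring.
rewrite nneseries_recl//; last first.
  by move=> l _; apply: sume_ge0 => w _; rewrite lee_fin weight_c_ge0.
rewrite big_ord1 /weight_c/= add0e -/(weight_c gamma s v) -nneseries_addn; last first.
  by move=> l; apply: sume_ge0 => w _; rewrite lee_fin weight_c_ge0.
under eq_eseriesr do rewrite addn1 E EFinM.
rewrite nneseriesZl; last by move=> k _; rewrite lee_fin Poi_ge0// mulr_ge0.
by rewrite nneseries_Poi ?mulr_ge0// mule1 ltey.
Qed.

Lemma p_a_mixture gamma PI s (x : J) U :
  p_a gamma PI s x U = mixture (weight_a gamma s) (fun l w => PI l w x) U.
Proof. by apply: eq_eseriesr => l _; rewrite (sum_weight_a (fun w => PI l w x U)). Qed.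

Lemma p_c_mixture gamma PI s v (x : J)
    (M : nat -> nat -> {measure set J -> \bar R}) U :
  (forall l w, PI l w x U = M l w U) -> (0 <= gamma)%R -> (0 <= v < s)%R ->
  p_c gamma PI s v x U = mixture (weight_c gamma s v) M U.
Proof.
move=> PM g0 /andP[v0 vs]; rewrite /p_c vs.
rewrite (eq_esum (b := fun lw => (fun l w => (Erl (l - w) gamma (s - v) * Poi (gamma * v) w)%:E
   * M l w U) lw.1 lw.2)); last by move=> lw _; rewrite PM.
rewrite (esum_pairs_lt (f := fun l w => (Erl (l - w) gamma (s - v) * Poi (gamma * v) w)%:E * M l w U)).
  by apply: eq_eseriesr => l _; rewrite (sum_weight_c (fun w => M l w U)).
move=> l w; rewrite mule_ge0// lee_fin mulr_ge0 ?Erl_ge0 ?Poi_ge0 ?mulr_ge0//.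
by rewrite subr_ge0 ltW.
Qed.

End mixtures.

Local Close Scope ereal_scope.

(** [Pi] reads its kernels only at [w <= k]. Elsewhere the truncated subtraction in [Pi_hat] makes
    the durations on the grid differ from those of [Pi_tilde]. *)
Lemma eq_Pi d (J : measurableType d) (R : realType)
    (Qd Qn Qd' Qn' : nat -> nat -> J -> set J -> \bar R) :
  (forall k w, (w <= k)%N -> Qd k w = Qd' k w /\ Qn k w = Qn' k w) ->
  forall l w, Pi Qd Qn l w = Pi Qd' Qn' l w.
Proof.
move=> QQ; elim=> [|l IH] [|w] //=.
  apply/funext => x; apply/funext => U; apply: eq_bigr => i _.
  by rewrite IH (QQ l i (leq_ord i)).2.
by apply/funext => x; apply/funext => U; case: ifP => // wl; rewrite IH (QQ l w wl).1.
Qed.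

Definition grid (R : realType) (gamma : R) (k : nat) : R := k%:R / gamma.

Lemma valid_grid (R : realType) (gamma : R) : 0 < gamma -> valid_arrivals (grid gamma).
Proof.
move=> g0; split=> [n|m n mn]; first by rewrite divr_ge0// ltW.
by rewrite ler_pM2r ?invr_gt0// ler_nat.
Qed.

Lemma Pi_tilde_grid d (J : measurableType d) (R : realType) (gamma : R)
    (Lambda : R -> R -> J -> {charge set J -> \bar R}) l w :
  Pi_tilde gamma Lambda l w = Pi_hat gamma Lambda (grid gamma) l w.
Proof.
apply: eq_Pi => k v vk; rewrite /grid.
by rewrite -mulrBl natrB// (_ : k.+1%:R - (k%:R - v%:R) = v.+1%:R)// -!natr1; ring.
Qed.

Local Open Scope ereal_scope.

(** * Comparison of [p_a] and [p_c] for two sequences of arrival times *)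

Section comparison.
Context d (J : measurableType d) (R : realType).
Variables (Lambda : R -> R -> J -> {charge set J -> \bar R}) (gamma0 : R).
Hypothesis singletons : forall x : J, measurable [set x].
Hypothesis HL : intensity_family gamma0 Lambda.
Variable gamma : R.
Hypothesis gamma_gt0 : (0 < gamma)%R.
Hypothesis gamma0_le : (gamma0 <= gamma)%R.
Variable K : R.
Hypothesis K0 : (0 < K)%R.
Hypothesis lipK : forall (x : J) (s1 s2 v1 v2 : R), (0 <= s1)%R -> (0 <= s2)%R ->
  (0 <= v1)%R -> (0 <= v2)%R ->
  tv (fun A => Lambda s1 v1 x A - Lambda s2 v2 x A) setT
    <= (K * (`|s1 - s2| + `|v1 - v2|))%:E.

Let gamma_ge0 : (0 <= gamma)%R. Proof. exact: ltW. Qed.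

(** The average of [Pi_bound] under the Poisson law of parameter [gamma * s]; the exponent combines
    its moment generating function at 1 with the factor [e ^ (- L)]. *)
Definition error_bound (s : R) (L : nat) (r : R) : R :=
  (L%:R * (2 * (gamma^-1 * (K * (3 * r))))
   + 2 * expR (gamma * s * (expR 1 - 1) - L%:R))%R.

Lemma sum_Poi_Pi_bound s L r (N : nat -> nat -> {measure set J -> \bar R}) :
  (0 <= s)%R -> (0 <= r)%R ->
  (forall l, \sum_(w < l.+1) N l w setT <= (Pi_bound gamma K L r l)%:E) ->
  \sum_(0 <= l <oo) (Poi (gamma * s) l)%:E * (\sum_(w < l.+1) N l w setT)
    <= (error_bound s L r)%:E.
Proof.
move=> s0 r0 hN; have gs0 : (0 <= gamma * s)%R by rewrite mulr_ge0// ltW.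
have P0 l : (0 <= Poi (gamma * s) l)%R by exact: Poi_ge0.
set a := (L%:R * (2 * (gamma^-1 * (K * (3 * r)))))%R.
have a0 : (0 <= a)%R by rewrite /a !mulr_ge0 ?invr_ge0// ltW.
apply: (@le_trans _ _ (\sum_(0 <= l <oo) (a%:E * (Poi (gamma * s) l)%:E +
    (2 * expR (- L%:R))%:E * (Poi (gamma * s) l * expR (1 * l%:R))%:E))).
  apply: lee_nneseries => [l _ _|l _].
    by rewrite mule_ge0 ?lee_fin//; exact: sume_ge0.
  apply: le_trans (lee_wpmul2l _ (hN l)) _; rewrite ?lee_fin//.
  rewrite le_eqVlt; apply/orP; left; apply/eqP; rewrite /Pi_bound -/a.
  by rewrite mul1r expRD; ring.
rewrite nneseriesD; last 2 first.
- by move=> l _; rewrite mule_ge0// lee_fin.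
- by move=> l _; rewrite mule_ge0// lee_fin mulr_ge0 ?expR_ge0.
rewrite !nneseriesZl; last 2 first.
- by move=> l _; rewrite lee_fin mulr_ge0 ?expR_ge0.
- by move=> l _; rewrite lee_fin.
rewrite nneseries_Poi// nneseries_Poi_expR// mule1 -EFinM -EFinD lee_fin.
by rewrite /error_bound -/a expRD; lra.
Qed.

Lemma mass_le1 (M : nat -> {measure set J -> \bar R}) l :
  \sum_(w < l.+1) M w setT = 1 -> forall w, (w <= l)%N -> M w setT <= 1.
Proof.
move=> <- w wl; rewrite (bigD1 (Ordinal (wl : (w < l.+1)%N)))//= leeDl//.
exact: sume_ge0.
Qed.

Section one_point.
Variable x : J.

Lemma phat_a_fin chi s U : valid_arrivals chi -> (0 <= s)%R -> measurable U ->
  phat_a gamma Lambda chi s x U \is a fin_num.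
Proof.
move=> vc s0 mU.
(* Comparing [chi] with itself for [L = 0] and [r = 0] serves only to represent the terms by
   measures of total mass 1 per level. *)
have [M [M' [N [PM _ _ M1 _]]]] := Pi_hat_close singletons HL gamma_gt0 gamma0_le K0 lipK
  (L := 0) x vc vc (lexx _) (fun k _ => ltac:(by rewrite subrr normr0)).
rewrite /phat_a p_a_mixture (eq_mixture _ (M' := fun l w => M l w)); last by move=> *; exact: PM.
apply: mixture_fin => //; first by move=> *; exact: weight_a_ge0.
  exact: weight_a_summable.
by move=> l w; apply: mass_le1; have [] := M1 l.
Qed.

Lemma phat_c_fin chi s v U : valid_arrivals chi -> (0 <= v <= s)%R -> measurable U ->
  phat_c gamma Lambda chi s v x U \is a fin_num.
Proof.
move=> vc vs0 mU; have /andP[v0 vs] := vs0.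
have [M [M' [N [PM _ _ M1 _]]]] := Pi_hat_close singletons HL gamma_gt0 gamma0_le K0 lipK
  (L := 0) x vc vc (lexx _) (fun k _ => ltac:(by rewrite subrr normr0)).
have [vls|] := boolP (v < s)%R; last by rewrite /phat_c /p_c => /negbTE ->.
rewrite /phat_c (p_c_mixture (M := M))//; [|by move=> *; exact: PM|by rewrite v0].
apply: mixture_fin => //; first by move=> *; exact: weight_c_ge0.
  exact: weight_c_summable.
by move=> l w; apply: mass_le1; have [] := M1 l.
Qed.

Variables (chi chi' : nat -> R) (L : nat) (r : R).
Hypothesis vc : valid_arrivals chi.
Hypothesis vc' : valid_arrivals chi'.
Hypothesis r0 : (0 <= r)%R.
Hypothesis hr : (forall k, (k <= L)%N -> `|chi k - chi' k| <= r)%R.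

Lemma phat_a_comparison s (g : set J -> \bar R) : (0 <= s)%R ->
  (forall U, measurable U -> g U \is a fin_num) ->
  tv (fun U => phat_a gamma Lambda chi s x U - g U) setT <=
  tv (fun U => phat_a gamma Lambda chi' s x U - g U) setT + (error_bound s L r)%:E.
Proof.
move=> s0 gfin.
have [M [M' [N [PM PM' MN M1 hN]]]] :=
  Pi_hat_close singletons HL gamma_gt0 gamma0_le K0 lipK x vc vc' r0 hr.
have E (PI : nat -> nat -> J -> set J -> \bar R) (M0 : nat -> nat -> {measure set J -> \bar R}) :
    (forall l w A, measurable A -> PI l w x A = M0 l w A) ->
    tv (fun U => p_a gamma PI s x U - g U) setT =
    tv (fun U => mixture (weight_a gamma s) M0 U - g U) setT.
  move=> h; apply: eq_tv => U mU; rewrite p_a_mixture; congr (_ - _).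
  by apply: eq_mixture => l w; exact: h.
rewrite (E _ _ PM) (E _ _ PM').
apply: le_trans (tv_mixture_le _ _ _ _ MN gfin) _.
- by move=> *; exact: weight_a_ge0.
- exact: weight_a_summable.
- by move=> l w; apply: mass_le1; have [] := M1 l.
- by move=> l w; apply: mass_le1; have [] := M1 l.
apply: leeD => //; apply: le_trans (sum_Poi_Pi_bound s0 r0 hN).
apply: lee_nneseries => [l _ _|l _].
  by apply: mixture_term_ge0 => *; exact: weight_a_ge0.
rewrite (sum_weight_a (fun w => N l w setT)); apply: lee_wpmul2l.
  by rewrite lee_fin Poi_ge0// mulr_ge0// ltW.
by rewrite big_ord_recr/= leeDr//; exact: sume_ge0.
Qed.

Lemma phat_c_comparison s v (g : R -> set J -> \bar R) : (0 <= v <= s)%R ->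
  (forall v' U, (0 <= v' <= s)%R -> measurable U -> g v' U \is a fin_num) ->
  \int[lebesgue_measure]_(v' in `[0%R, v])
    tv (fun U => phat_c gamma Lambda chi s v' x U - g v' U) setT <=
  \int[lebesgue_measure]_(v' in `[0%R, v])
    tv (fun U => phat_c gamma Lambda chi' s v' x U - g v' U) setT + (error_bound s L r)%:E.
Proof.
move=> /andP[v0 vs] gfin.
have s0 : (0 <= s)%R by exact: le_trans vs.
have [M [M' [N [PM PM' MN M1 hN]]]] :=
  Pi_hat_close singletons HL gamma_gt0 gamma0_le K0 lipK x vc vc' r0 hr.
have in0v v' : `[0%R, v]%classic v' -> (0 <= v' <= s)%R.
  by rewrite /= in_itv/= => /andP[-> /le_trans->].
have w0 v' l w : `[0%R, v]%classic v' -> (0 <= weight_c gamma s v' l w)%R.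
  by move=> /in0v ?; exact: weight_c_ge0.
have mw l w : measurable_fun setT (fun v' => (weight_c gamma s v' l w)%:E).
  apply/measurable_EFinP; have [wl|lw] := ltnP w l; last first.
    under eq_fun do rewrite /weight_c ltnNge lw/=.
    exact: measurable_cst.
  under eq_fun do rewrite /weight_c wl -(subnSK wl) Erl_PoiE//.
  apply: measurable_funM => //.
  by apply: continuous_measurable_fun; exact: continuous_beta_integrand.
have mterm l w : measurable_fun setT (fun v' => (weight_c gamma s v' l w)%:E * N l w setT).
  by apply: emeasurable_funM.
have pointwise v' : `[0%R, v]%classic v' ->
    tv (fun U => phat_c gamma Lambda chi s v' x U - g v' U) setT <=
    tv (fun U => phat_c gamma Lambda chi' s v' x U - g v' U) setT +
    mixture (weight_c gamma s v') N setT.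
  (* When [v = s] the endpoint [v' = s] occurs; both kernels [p_c] are 0 there by definition. *)
  move=> v'v; have [vls|] := boolP (v' < s)%R; last first.
    move=> /negbTE h; rewrite /phat_c /p_c h leeDl//.
    by apply: nneseries_ge0 => l _ _; apply: mixture_term_ge0 => *; exact: w0.
  have v's := in0v _ v'v; have v'0 : (0 <= v' < s)%R by rewrite vls andbT; case/andP: v's.
  have E (PI : nat -> nat -> J -> set J -> \bar R) (M0 : nat -> nat -> {measure set J -> \bar R}) :
      (forall l w A, measurable A -> PI l w x A = M0 l w A) ->
      tv (fun U => p_c gamma PI s v' x U - g v' U) setT =
      tv (fun U => mixture (weight_c gamma s v') M0 U - g v' U) setT.
    move=> h; apply: eq_tv => U mU; rewrite (p_c_mixture (M := M0))//.
    by move=> l w; exact: h.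
  rewrite (E _ _ PM) (E _ _ PM').
  apply: tv_mixture_le => //.
  - by move=> *; exact: w0.
  - exact: weight_c_summable.
  - by move=> l w; apply: mass_le1; have [] := M1 l.
  - by move=> l w; apply: mass_le1; have [] := M1 l.
  - by move=> U; exact: gfin.
apply: le_trans (@ge0_integral_lowerD _ _ _ lebesgue_measure _ _ _ _ _ _ _ _ _ pointwise) _ => //.
- apply: ge0_emeasurable_sum => [l v' v'v _|l _].
    by apply: mixture_term_ge0 => *; exact: w0.
  by apply: emeasurable_sum => w; apply: measurable_funTS; exact: mterm.
- by move=> v' _; exact: tv_ge0.
- by move=> v' _; exact: tv_ge0.
- by move=> v' v'v; apply: nneseries_ge0 => l _ _; apply: mixture_term_ge0 => *; exact: w0.
apply: leeD => //; rewrite integral_nneseries//; last 2 first.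
- by move=> l; apply: emeasurable_sum => w; apply: measurable_funTS; exact: mterm.
- by move=> l v' v'v; apply: mixture_term_ge0 => *; exact: w0.
apply: le_trans (sum_Poi_Pi_bound s0 r0 hN).
apply: lee_nneseries => [l _ _|l _].
  by apply: integral_ge0 => v' v'v; apply: mixture_term_ge0 => *; exact: w0.
rewrite ge0_integral_sum//; last 2 first.
- by move=> w; apply: measurable_funTS; exact: mterm.
- by move=> w v' v'v; rewrite mule_ge0// lee_fin w0.
rewrite ge0_sume_distrr//; apply: lee_sum => w _.
rewrite ge0_integralZr//; last 2 first.
- apply: measurable_funTS; exact: mw.
- by move=> v' v'v; rewrite lee_fin w0.
apply: lee_wpmul2r => //.
have [wl|lw] := ltnP w l; last first.
  under eq_integral do rewrite /weight_c ltnNge lw/=.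
  by rewrite integral0 lee_fin Poi_ge0// mulr_ge0// ltW.
(* [integral_Erl_Poi] is applied with [n + 1 = l - w], so that its index [n + w + 1] is [l]. *)
have -> : Poi (gamma * s) l = Poi (gamma * s) (l - w.+1 + w).+1.
  by rewrite -addnS subnK.
rewrite -[leRHS]/((_)%:E); apply: le_trans (integral_Erl_Poi _ _ gamma_gt0 (v := v) _); last by rewrite v0.
by under eq_integral do rewrite /weight_c wl -(subnSK wl).
Qed.

End one_point.
End comparison.

(* [E] is a countable union of the cells on which the integer parts of
   [m.+1 * X k], for [k <= L], are prescribed. *)
Lemma measurable_cylinder d (T : measurableType d) (R : realType)
    (X : nat -> {mfun T >-> R}) (E : set T) :
  (forall w, E w -> exists L m : nat, forall w',
    (forall k, (k <= L)%N -> `|X k w - X k w'| <= m.+1%:R^-1)%R -> E w') ->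
  measurable E.
Proof.
move=> openE.
pose box (i : nat * nat * seq int) : set T :=
  \bigcap_(k in `I_i.1.1.+1) (X k @^-1` [set x : R | Num.floor (i.1.2.+1%:R * x)%R = nth 0%R i.2 k]).
have mbox i : measurable (box i).
  rewrite /box bigcap_mkord; apply: bigsetI_measurable => k _; rewrite -[X in measurable X]setTI.
  apply: (measurable_funP (X k)) => //.
  rewrite (_ : [set x | _] = (fun x => i.1.2.+1%:R * x)%R @^-1`
     `[(nth 0%R i.2 k)%:~R, (nth 0%R i.2 k + 1)%R%:~R[%classic); last first.
    apply/seteqP; split=> x /=; rewrite in_itv/=.
      by move=> <-; exact: Num.Theory.floor_itv.
    by move=> h; apply: Num.Theory.floor_def.
  rewrite -[X in measurable X]setTI.
  have mf : measurable_fun setT (fun x : R => i.1.2.+1%:R * x)%R by exact: measurable_funM.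
  exact: mf.
pose good n : set T := if unpickle n is Some i then
  (if `[< box i `<=` E >] then box i else set0) else set0.
have -> : E = \bigcup_n good n.
  apply/seteqP; split=> [w Ew|w [n _]]; last first.
    by rewrite /good; case: unpickle => // i; case: asboolP => // + bw; exact.
  have [L [m h]] := openE w Ew.
  pose z := [seq Num.floor (m.+1%:R * X k w)%R | k <- iota 0 L.+1].
  have zE k : (k <= L)%N -> nth 0%R z k = Num.floor (m.+1%:R * X k w)%R.
    move=> kL; rewrite (nth_map 0%N) ?size_iota// nth_iota//.
  have inbox w' : box (L, m, z) w' ->
     forall k, (k <= L)%N -> Num.floor (m.+1%:R * X k w')%R = Num.floor (m.+1%:R * X k w)%R.
    by move=> bw k kL; rewrite -zE//; exact: bw.
  exists (pickle (L, m, z)) => //; rewrite /good pickleK.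
  rewrite ifT.
    by move=> k /= kL; rewrite zE.
  apply/asboolP => w' /inbox w'box; apply: h => k kL.
  have := w'box k kL => fl.
  have m0 : (0 < m.+1%:R :> R)%R by rewrite ltr0n.
  have := Num.Theory.floor_itv (m.+1%:R * X k w)%R.
  have := Num.Theory.floor_itv (m.+1%:R * X k w')%R.
  rewrite fl intrD => /andP[a1 a2] /andP[b1 b2].
  rewrite -(ler_pM2l m0) mulfV ?gt_eqF// -{1}(gtr0_norm m0) -normrM mulrBr ler_norml.
  by apply/andP; split; lra.
rewrite /good; apply: bigcup_measurable => n _; case: unpickle => // i.
by case: ifP.
Qed.

(** * Dependence of the errors on the arrival times *)

Lemma ereal_sup_image_leD (R : realType) (T : Type) (f g : T -> \bar R) (c : \bar R) :
  (forall x, f x <= g x + c) ->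
  ereal_sup [set f x | x in setT] <= ereal_sup [set g x | x in setT] + c.
Proof.
move=> fg; apply: ge_ereal_sup => _ [x _ <-]; apply: le_trans (fg x) _.
by rewrite leeD2r//; apply: ereal_sup_ubound; exists x.
Qed.

Section errors.
Context d (J : measurableType d) (R : realType).
Variables (Lambda : R -> R -> J -> {charge set J -> \bar R}) (gamma0 : R).
Hypothesis singletons : forall x : J, measurable [set x].
Hypothesis HL : intensity_family gamma0 Lambda.
Variable gamma : R.
Hypothesis gamma_gt0 : (0 < gamma)%R.
Hypothesis gamma0_le : (gamma0 <= gamma)%R.
Variable K : R.
Hypothesis K0 : (0 < K)%R.
Hypothesis lipK : forall (x : J) (s1 s2 v1 v2 : R), (0 <= s1)%R -> (0 <= s2)%R ->
  (0 <= v1)%R -> (0 <= v2)%R ->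
  tv (fun A => Lambda s1 v1 x A - Lambda s2 v2 x A) setT
    <= (K * (`|s1 - s2| + `|v1 - v2|))%:E.

Let valid_gridP := valid_grid gamma_gt0.

Lemma ptilde_a_grid : ptilde_a gamma Lambda = phat_a gamma Lambda (grid gamma).
Proof.
congr (p_a gamma); apply/funext => l; apply/funext => w; exact: Pi_tilde_grid.
Qed.

Lemma ptilde_c_grid : ptilde_c gamma Lambda = phat_c gamma Lambda (grid gamma).
Proof.
congr (p_c gamma); apply/funext => l; apply/funext => w; exact: Pi_tilde_grid.
Qed.

Section perturbation.
Variables (chi chi' : nat -> R) (L : nat) (r : R).
Hypothesis vc : valid_arrivals chi.
Hypothesis vc' : valid_arrivals chi'.
Hypothesis r0 : (0 <= r)%R.
Hypothesis hr : (forall k, (k <= L)%N -> `|chi k - chi' k| <= r)%R.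

Lemma error_a_perturb s : (0 <= s)%R ->
  error_a gamma Lambda chi s <=
  error_a gamma Lambda chi' s + (error_bound gamma K s L r)%:E.
Proof.
move=> s0; apply: ereal_sup_image_leD => x; rewrite ptilde_a_grid.
apply: (phat_a_comparison singletons HL) => // U mU.
exact: (phat_a_fin singletons HL gamma_gt0 gamma0_le K0 lipK).
Qed.

Lemma error_c_perturb s v : (0 <= v <= s)%R ->
  error_c gamma Lambda chi s v <=
  error_c gamma Lambda chi' s v + (error_bound gamma K s L r)%:E.
Proof.
move=> vs; apply: ereal_sup_image_leD => x; rewrite ptilde_c_grid.
apply: (phat_c_comparison singletons HL) => // v' U v's mU.
exact: (phat_c_fin singletons HL gamma_gt0 gamma0_le K0 lipK).
Qed.

End perturbation.

Lemma error_a_grid s : (0 <= s)%R -> error_a gamma Lambda (grid gamma) s <= 0.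
Proof.
move=> s0; apply: ge_ereal_sup => _ [x _ <-]; rewrite ptilde_a_grid.
apply: tv_self => A mA; exact: (phat_a_fin singletons HL gamma_gt0 gamma0_le K0 lipK).
Qed.

Lemma error_c_grid s v : (0 <= v <= s)%R ->
  error_c gamma Lambda (grid gamma) s v <= 0.
Proof.
move=> /andP[v0 vs]; apply: ge_ereal_sup => _ [x _ <-]; rewrite ptilde_c_grid.
rewrite integral0_eq// => v' /=; rewrite in_itv/= => /andP[v'0 v'v].
apply/eqP; rewrite eq_le tv_ge0 andbT.
apply: tv_self => A mA; apply: (phat_c_fin singletons HL gamma_gt0 gamma0_le K0 lipK) => //.
by rewrite v'0 (le_trans v'v).
Qed.

(** [L] is fixed first, large enough for the exponential term; the linear term, whose coefficient
    grows with [L], is then made small through [m]. *)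
Lemma error_bound_small s (e : R) : (0 < e)%R ->
  exists L m : nat, (error_bound gamma K s L (m.+1%:R^-1) < e)%R.
Proof.
move=> e0; set A := (gamma * s * (expR 1 - 1))%R.
pose L := Num.bound `|A - ln (e / 4)|%R.
have e4 : (0 < e / 4)%R by rewrite divr_gt0.
have hL : (2 * expR (A - L%:R) < e / 2)%R.
  have : (A - ln (e / 4) < L%:R)%R by apply: le_lt_trans (ler_norm _) _; exact: archi_boundP.
  rewrite ltrBlDr -ltrBlDl => h.
  have : (expR (A - L%:R) < e / 4)%R by rewrite -[ltRHS](lnK e4) ltr_expR; lra.
  lra.
set C := (L%:R * (2 * (gamma^-1 * (K * 3))))%R.
have C0 : (0 <= C)%R by rewrite /C !mulr_ge0 ?invr_ge0 ?ltW.
exists L, (Num.bound (C / (e / 2))); rewrite /error_bound -/A.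
set m := Num.bound _.
have m1 : (C / (e / 2) < m.+1%:R)%R.
  apply: lt_le_trans (archi_boundP _) _; last by rewrite ler_nat.
  by apply: divr_ge0 => //; rewrite ltW// divr_gt0.
have : (C * m.+1%:R^-1 < e / 2)%R.
  by rewrite ltr_pdivrMr ?ltr0n// mulrC -ltr_pdivrMr ?divr_gt0.
have -> : (L%:R * (2 * (gamma^-1 * (K * (3 * m.+1%:R^-1)))) = C * m.+1%:R^-1)%R.
  by rewrite /C; ring.
by move=> h; rewrite [ltRHS](splitr e) ltrD.
Qed.

(* The error event must be shown measurable, as [P] is arbitrary on other sets.
   The supremum over an arbitrary [J] is harmless because the error is uniformly
   continuous in the arrival times. *)
Lemma measurable_perturbation dO (Omega : measurableType dO)
    (X : nat -> {mfun Omega >-> R}) (err : (nat -> R) -> \bar R) s (t : R) :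
  (forall w, valid_arrivals (fun n => X n w)) ->
  (forall chi chi' L r, valid_arrivals chi -> valid_arrivals chi' -> (0 <= r)%R ->
    (forall k, (k <= L)%N -> `|chi k - chi' k| <= r)%R ->
    err chi <= err chi' + (error_bound gamma K s L r)%:E) ->
  measurable [set w | t%:E <= err (fun n => X n w)].
Proof.
move=> vX hp; rewrite (_ : [set w | _] = ~` [set w | err (fun n => X n w) < t%:E]); last first.
  apply/seteqP; split=> w /=; rewrite ltNge; first by move=> ->.
  by move=> /negP; rewrite negbK.
apply: measurableC; apply: (measurable_cylinder (X := X)) => w /= ew.
have [e e0 he] : exists2 e : R, (0 < e)%R & err (fun n => X n w) + e%:E <= t%:E.
  case: (err _) ew => [y| |] //; last by exists 1%R => //; rewrite leNye.
  rewrite lte_fin => yt; exists (t - y)%R; first by rewrite subr_gt0.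
  by rewrite -EFinD lee_fin; lra.
have [L [m hm]] := error_bound_small s e0.
exists L, m => w' hw'.
have := hp _ _ L m.+1%:R^-1%R (vX w') (vX w).
move=> /(_ _ _)/le_lt_trans; apply.
- by rewrite invr_ge0.
- by move=> k kL; rewrite distrC; exact: hw'.
case: (err (fun n => X n w)) he ew => [y| |] // he _.
by apply: lt_le_trans he; rewrite -!EFinD lte_fin ltrD2l.
Qed.

End errors.

(** * Deviations of the arrival times *)

Section density.
Context d1 d2 (T1 : measurableType d1) (T2 : measurableType d2) (R : realType).
Variables (mu : {measure set T1 -> \bar R}) (nu : {measure set T2 -> \bar R}).
Variables (X : T1 -> T2) (G : T1 -> R).
Hypothesis mX : measurable_fun setT X.
Hypothesis mG : measurable_fun setT G.
Hypothesis G0 : forall w, (0 <= G w)%R.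
Hypothesis GX : forall B, measurable B -> \int[mu]_w (G w * \1_B (X w))%:E = nu B.

Lemma integral_density_nnsfun (g : {nnsfun T2 >-> R}) :
  \int[mu]_w (G w * g (X w))%:E = \int[nu]_y (g y)%:E.
Proof.
have mB y : measurable (g @^-1` [set y]) by exact: measurable_sfunP.
have mi y : measurable_fun setT (fun w => \1_(g @^-1` [set y]) (X w) : R).
  by apply: measurableT_comp.
transitivity (\int[mu]_w (\sum_(y \in range g)
    (y%:E * (G w * \1_(g @^-1` [set y]) (X w))%:E))).
  apply: eq_integral => w _; rewrite fimfunE mulrC.
  rewrite mulr_fsuml -fsumEFin//.
  by apply: eq_fsbigr => y _; rewrite -EFinM; congr (_%:E); ring.
rewrite ge0_integral_fsum//; last 2 first.
- by move=> y; apply: emeasurable_funM => //; apply/measurable_EFinP; exact: measurable_funM.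
- move=> y w _; rewrite -EFinM lee_fin mulrCA mulr_ge0//.
  rewrite indicE; case: (boolP (X w \in _)) => [/set_mem <-|_]; last by rewrite mulr0.
  by rewrite mulr1.
rewrite integral_nnsfun// patch_setT sintegralE.
apply: eq_fsbigr => y /set_mem[z _ <-].
rewrite ge0_integralZl ?GX ?lee_fin//.
- by apply/measurable_EFinP; exact: measurable_funM.
- by move=> w _; rewrite lee_fin mulr_ge0.
Qed.

(** Extends [GX] from indicators to nonnegative functions by monotone convergence. It is used with
    [X] the identity and [G] the exponential density, to compute expectations, and with [G] a
    product of factors independent of [X], to split off one factor. *)
Lemma integral_density (f : T2 -> R) : measurable_fun setT f ->
  (forall y, (0 <= f y)%R) ->
  \int[mu]_w (G w * f (X w))%:E = \int[nu]_y (f y)%:E.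
Proof.
move=> mf f0.
have mf' : measurable_fun setT (fun y => (f y)%:E) by apply/measurable_EFinP.
have [g [ndg gf]] := approximation measurableT mf' (fun y _ => f0 y).
have ndg' y : {homo (fun n => (g n y)%:E) : n m / (n <= m)%N >-> n <= m}.
  by move=> n m nm; rewrite lee_fin; exact/lefP/ndg.
have lhs : (fun n => \int[nu]_y (g n y)%:E) @ \oo --> \int[nu]_y (f y)%:E.
  rewrite (_ : \int[nu]_y (f y)%:E = \int[nu]_y limn (fun n => (g n y)%:E)).
    apply: cvg_monotone_convergence => //.
    - by move=> n; apply/measurable_EFinP.
    - by move=> n y _; rewrite lee_fin.
  by apply: eq_integral => y _; apply/esym/cvg_lim => //; exact: gf.
have rhs : (fun n => \int[mu]_w (G w * g n (X w))%:E) @ \oo --> \int[mu]_w (G w * f (X w))%:E.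
  rewrite (_ : \int[mu]_w (G w * f (X w))%:E =
      \int[mu]_w limn (fun n => (G w * g n (X w))%:E)).
    apply: cvg_monotone_convergence => //.
    - move=> n; apply/measurable_EFinP; apply: measurable_funM => //.
      by apply: measurableT_comp.
    - by move=> n y _; rewrite lee_fin mulr_ge0.
    - by move=> w _ n m nm; rewrite lee_fin ler_wpM2l// -lee_fin; exact: ndg'.
  apply: eq_integral => w _; apply/esym/cvg_lim => //.
  under eq_fun do rewrite EFinM.
  by rewrite EFinM; apply: cvgeZl => //; exact: gf.
apply: (cvg_unique _ rhs) => //.
rewrite (_ : (fun n => _) = (fun n => \int[nu]_y (g n y)%:E))//.
by apply/funext => n; exact: integral_density_nnsfun.
Qed.

End density.

Section independent_product.
Context d (T : measurableType d) (R : realType) (P : probability T R).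
Variables (X : nat -> {RV P >-> R}) (f : R -> R) (c : R).
Hypothesis indep : mutually_independent P (fun n => X n : T -> R).
Hypothesis mf : measurable_fun setT f.
Hypothesis f0 : forall x, (0 <= f x)%R.
Hypothesis c0 : (0 <= c)%R.
Hypothesis fc : forall n, \int[P]_w (f (X n w))%:E = c%:E.

Let event (I : seq nat) (B : nat -> set R) : set T := \bigcap_(i in [set` I]) (X i @^-1` B i).

Let mX n B : measurable B -> measurable (X n @^-1` B).
Proof. by move=> mB; rewrite -[X in measurable X]setTI; exact: measurable_funP. Qed.

Let mevent I B : (forall i, measurable (B i)) -> measurable (event I B).
Proof. by move=> mB; apply: fin_bigcap_measurable => // i _; exact: mX. Qed.

Let mprod k : measurable_fun setT (fun w => \prod_(i < k) f (X i w))%R.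
Proof.
by apply: measurable_prod => i _; apply: measurableT_comp.
Qed.

(** Independence is given for events only. The induction converts indicators into factors [f (X i)]
    one at a time, so it must carry an arbitrary event in the variables of index at least [k]. *)
Lemma integral_prod_event k I B : uniq I -> (forall i, i \in I -> (k <= i)%N) ->
  (forall i, measurable (B i)) ->
  \int[P]_w ((\prod_(i < k) f (X i w)) * \1_(event I B) w)%:E =
  (c ^+ k)%:E * \prod_(i <- I) P (X i @^-1` B i).
Proof.
elim: k I B => [|k IH] I B uI kI mB.
  under eq_integral do rewrite big_ord0 mul1r.
  rewrite integral_indic//; last exact: mevent.
  by rewrite setIT expr0 mul1e; exact: indep.
pose G w := ((\prod_(i < k) f (X i w)) * \1_(event I B) w)%R.
have PIfin : \prod_(i <- I) P (X i @^-1` B i) \is a fin_num.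
  rewrite big_seq; elim/big_ind: _ => // [x y xf yf|i _]; first by rewrite fin_numM.
  by rewrite fin_num_measure//; exact: mX.
have PI0 : (0 <= c ^+ k * fine (\prod_(i <- I) P (X i @^-1` B i)))%R.
  rewrite mulr_ge0 ?exprn_ge0// fine_ge0//.
  by elim/big_ind: _ => // x y x0 y0; rewrite mule_ge0.
pose nu : {measure set R -> \bar R} := mscale (NngNum PI0) (distribution P (X k)).
have nuE D : nu D = (c ^+ k)%:E * \prod_(i <- I) P (X i @^-1` B i) * P (X k @^-1` D).
  by rewrite -(fineK PIfin) -EFinM.
(* The event [X k] in [D] joins the others, and the induction hypothesis for [k :: I] identifies the
   law of [X k] weighted by [G] as a multiple of its plain law. *)
have GX D : measurable D -> \int[P]_w (G w * \1_D (X k w))%:E = nu D.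
  move=> mD; pose B' i := if i == k then D else B i.
  have kI' : k \notin I by apply/negP => /kI; rewrite ltnn.
  have EB : forall i, i \in I -> B' i = B i.
    by move=> i iI; rewrite /B'; case: eqP => // ik; move: kI'; rewrite -ik iI.
  have := IH (k :: I) B'.
  rewrite /= kI' uI => /(_ isT) h.
  rewrite nuE muleAC -muleA.
  have -> : P (X k @^-1` D) * \prod_(i <- I) P (X i @^-1` B i) =
      \prod_(i <- k :: I) P (X i @^-1` B' i).
    rewrite big_cons {1}/B' eqxx; congr (_ * _).
    by rewrite [LHS]big_seq [RHS]big_seq; apply: eq_bigr => i iI; rewrite EB.
  rewrite -h.
  - apply: eq_integral => w _; rewrite /G -mulrA; congr (_ * _)%:E.
    have -> : event (k :: I) B' = event I B `&` X k @^-1` D.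
      apply/seteqP; split=> [z zI|z [zI zk] i].
        split; last by have := zI k; rewrite /B' eqxx; apply; rewrite /= mem_head.
        by move=> i iI; have := zI i; rewrite EB//; apply; rewrite /= in_cons iI orbT.
      rewrite /= inE => /orP[/eqP->|iI]; first by rewrite /B' eqxx.
      by rewrite EB//; exact: zI.
    by rewrite indicI.
  - by move=> i; rewrite in_cons => /orP[/eqP->//|/kI/ltnW].
  - by move=> i; rewrite /B'; case: ifP.
have mG : measurable_fun setT G.
  apply: measurable_funM => //; apply: measurable_indic; exact: mevent.
have G0 w : (0 <= G w)%R by rewrite mulr_ge0// prodr_ge0.
transitivity (\int[P]_w (G w * f (X k w))%:E).
  by apply: eq_integral => w _; rewrite big_ord_recr/= /G mulrAC.
rewrite (integral_density (measurable_funPT (X k)) mG G0 GX mf f0).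
have mf' : measurable_fun setT (fun y => (f y)%:E) by apply/measurable_EFinP.
rewrite ge0_integral_mscale//; last by move=> y _; rewrite lee_fin.
rewrite ge0_integral_distribution//.
rewrite fc/= EFinM fineK// exprSr EFinM -!muleA; congr (_ * _).
by rewrite muleC.
Qed.

Lemma integral_prod k : \int[P]_w (\prod_(i < k) f (X i w))%:E = (c ^+ k)%:E.
Proof.
have := @integral_prod_event k [::] (fun=> setT) isT (fun i => ltac:(by [])) (fun=> measurableT).
rewrite big_nil mule1 => <-; apply: eq_integral => w _.
by rewrite indicE mem_set ?mulr1// => i.
Qed.

End independent_product.

Local Close Scope ereal_scope.

Section chernoff.
Context d (T : measurableType d) (R : realType) (P : probability T R).
Variables (gamma : R) (chi : nat -> {RV P >-> R}).
Hypothesis gamma_gt0 : 0 < gamma.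
Hypothesis Hchi : poisson_arrivals gamma chi.

(** Exponential tilting: the integrand is a multiple of the exponential density of rate
    [gamma - theta]. *)
Lemma integral_exponential_pdf_expR (theta : R) : theta < gamma ->
  (\int[lebesgue_measure]_x (exponential_pdf gamma x * expR (theta * x))%:E
   = (gamma / (gamma - theta))%:E)%E.
Proof.
move=> tg; have gt0 : 0 < gamma - theta by rewrite subr_gt0.
transitivity (\int[lebesgue_measure]_x
    ((gamma / (gamma - theta))%:E * (exponential_pdf (gamma - theta) x)%:E))%E.
  apply: eq_integral => x _; rewrite -EFinM; congr (_%:E).
  have [x0|x0] := leP 0 x; last by rewrite !lt0_exponential_pdf// mul0r mulr0.
  rewrite !exponential_pdfE// mulrA divfK ?gt_eqF// -mulrA -expRD.
  by congr (_ * expR _); ring.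
rewrite ge0_integralZl//.
- by rewrite integral_exponential_pdf// mule1.
- by apply/measurable_EFinP; exact: measurable_exponential_pdf.
- by move=> x _; rewrite lee_fin exponential_pdf_ge0// ltW.
- by rewrite lee_fin divr_ge0// ltW.
Qed.

Definition interarrival n : {RV P >-> R} := (chi n.+1 \- chi n)%R.

Lemma interarrival_mgf n (theta : R) : theta < gamma ->
  (\int[P]_w (expR (theta * interarrival n w))%:E = (gamma / (gamma - theta))%:E)%E.
Proof.
move=> tg.
have mf : measurable_fun setT (fun x : R => expR (theta * x)).
  by apply: measurableT_comp => //; exact: measurable_funM.
have mf' : measurable_fun setT (fun x : R => (expR (theta * x))%:E).
  exact/measurable_EFinP.
transitivity (\int[distribution P (interarrival n)]_y (expR (theta * y))%:E)%E.
  by rewrite ge0_integral_distribution// => y; rewrite lee_fin expR_ge0.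
rewrite -integral_exponential_pdf_expR//; apply/esym.
apply: (@integral_density _ _ _ _ R lebesgue_measure
  (distribution P (interarrival n)) id (exponential_pdf gamma) _ _ _ _
  (fun x => expR (theta * x))) => //.
- exact: measurable_exponential_pdf.
- by move=> x; apply: exponential_pdf_ge0; exact: ltW.
- move=> B mB; transitivity (exponential_prob gamma B).
    rewrite /exponential_prob [RHS]integral_mkcond; apply: eq_integral => x _.
    by rewrite patchE indicE/=; case: ifPn => xB; rewrite ?mulr1 ?mulr0.
  by rewrite -(arrivals_exp Hchi n mB).
Qed.

Lemma arrivals_sum k w : chi k w = \sum_(i < k) interarrival i w.
Proof.
elim: k => [|k IH]; first by rewrite big_ord0 (arrivals0 Hchi).
by rewrite big_ord_recr/= -IH addrC subrK.
Qed.

Lemma arrivals_mgf k (theta : R) : theta < gamma ->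
  (\int[P]_w (expR (theta * chi k w))%:E = ((gamma / (gamma - theta)) ^+ k)%:E)%E.
Proof.
move=> tg.
rewrite -(@integral_prod _ _ _ P interarrival (fun x => expR (theta * x))).
- by apply: eq_integral => w _; rewrite arrivals_sum mulr_sumr expR_sum.
- exact: arrivals_indep Hchi.
- by apply: measurableT_comp => //; exact: measurable_funM.
- by move=> x; exact: expR_ge0.
- by rewrite divr_ge0// ltW// subr_gt0.
- by move=> n; exact: interarrival_mgf.
Qed.

(** Since [(1 - v) (1 + v + 2 v^2) = 1 + v^2 (1 - 2 v)] is at least 1. Negative [v] are included,
    for the lower tail. *)
Lemma inv_1sub_le_expR (v : R) : v <= 1 / 2 -> (1 - v)^-1 <= expR (v + 2 * v ^+ 2).
Proof.
move=> v2; have v1 : 0 < 1 - v by lra.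
apply: le_trans (expR_ge1Dx _); rewrite -(ler_pM2l v1) mulfV ?gt_eqF//.
have := sqr_ge0 v; set z := v ^+ 2 => z0.
have : 0 <= z * (1 - 2 * v) by rewrite mulr_ge0//; lra.
rewrite /z expr2; lra.
Qed.

(** Markov's inequality for [expR (v * gamma * chi k)]. The sign of [v] selects the tail:
    [arrivals_deviation] takes [v = u] and [v = - u], both with [a = u * gamma * r]. *)
Lemma arrivals_chernoff k (v a : R) : v <= 1 / 2 ->
  (P [set w | (k%:R * v + a <= v * gamma * chi k w)%R] <=
    (expR (2 * k%:R * v ^+ 2 - a))%:E)%E.
Proof.
move=> v2; set A := [set w | _].
have v1 : 0 < 1 - v by lra.
have tg : v * gamma < gamma by rewrite gtr_pMl//; lra.
have mc : measurable_fun setT (fun w => v * gamma * chi k w) by exact: measurable_funM.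
have mA : measurable A.
  rewrite -[A]setTI (_ : A = (fun w => v * gamma * chi k w) @^-1` `[k%:R * v + a, +oo[%classic).
    exact: mc.
  by apply/seteqP; split=> w /=; rewrite in_itv/= andbT.
have h : ((expR (k%:R * v + a))%:E * P A <= \int[P]_w (expR (v * gamma * chi k w))%:E)%E.
  rewrite -[A]setIT -integral_indic// -ge0_integralZl//; last first.
    by apply/measurable_EFinP; exact: measurable_indic.
  apply: ge0_le_integral => //.
  - by apply: emeasurable_funM => //; apply/measurable_EFinP; exact: measurable_indic.
  - by apply/measurable_EFinP; exact: measurableT_comp.
  - move=> w _; rewrite -EFinM lee_fin indicE.
    case: (boolP (w \in A)) => [/set_mem wA|_]; last by rewrite mulr0 expR_ge0.
    by rewrite mulr1 ler_expR.
move: h; rewrite arrivals_mgf//.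
have -> : gamma / (gamma - v * gamma) = (1 - v)^-1.
  by field; rewrite !gt_eqF// subr_gt0.
rewrite -[P A]fineK ?fin_num_measure// -EFinM !lee_fin => h.
have e0 := expR_gt0 (k%:R * v + a).
rewrite -(ler_pM2l e0); apply: le_trans h _; rewrite -expRD.
apply: (@le_trans _ _ (expR (v + 2 * v ^+ 2) ^+ k)).
  apply: lerXn2r; rewrite ?nnegrE ?expR_ge0 ?invr_ge0 ?(ltW v1)//.
  exact: inv_1sub_le_expR.
by rewrite -expRM_natl ler_expR; lra.
Qed.

Lemma arrivals_deviation k (u r : R) : 0 <= u <= 1 / 2 ->
  (P [set w | (r < `|chi k w - k%:R / gamma|)%R] <=
    (2 * expR (2 * k%:R * u ^+ 2 - u * gamma * r))%:E)%E.
Proof.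
move=> /andP[u0 u2].
have h1 := arrivals_chernoff k (u * gamma * r) u2.
have u2' : - u <= 1 / 2 by lra.
have h2 := arrivals_chernoff k (u * gamma * r) u2'.
rewrite sqrrN in h2.
have mS (v a : R) : measurable [set w | (a <= v * gamma * chi k w)%R].
  have mc : measurable_fun setT (fun w => v * gamma * chi k w) by exact: measurable_funM.
  rewrite (_ : [set w | _] = (fun w => v * gamma * chi k w) @^-1` `[a, +oo[%classic).
    by rewrite -[X in measurable X]setTI; exact: mc.
  by apply/seteqP; split=> w /=; rewrite in_itv/= andbT.
rewrite mulrDl mul1r EFinD; apply: le_trans (leeD h1 h2).
apply: le_trans (measureU2 _ _ _); [|exact: mS|exact: mS].
apply: le_measure; rewrite ?inE.
- have mc : measurable_fun setT (fun w => `|chi k w - k%:R / gamma|).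
    by apply: measurableT_comp => //; exact: measurable_funB.
  rewrite (_ : [set w | _] = (fun w => `|chi k w - k%:R / gamma|) @^-1` `]r, +oo[%classic).
    by rewrite -[X in measurable X]setTI; exact: mc.
  by apply/seteqP; split=> w /=; rewrite in_itv/= andbT.
- exact: measurableU.
move=> w /=; rewrite ltr_normr => /orP[] h; [left|right].
  have -> : k%:R * u + u * gamma * r = u * gamma * (k%:R / gamma + r).
    by field; rewrite gt_eqF.
  by rewrite ler_wpM2l ?mulr_ge0 ?(ltW gamma_gt0)//; lra.
have -> : k%:R * - u + u * gamma * r = u * gamma * (r - k%:R / gamma).
  by field; rewrite gt_eqF.
have -> : - u * gamma * chi k w = u * gamma * (- chi k w) by ring.
by rewrite ler_wpM2l ?mulr_ge0 ?(ltW gamma_gt0)//; lra.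
Qed.

End chernoff.

Section deviation_event.
Context (R : realType) dO (Omega : measurableType dO) (P : probability Omega R).
Variables (gamma K s : R) (chi : nat -> {RV P >-> R}) (err : (nat -> R) -> \bar R).
Hypothesis gamma_gt0 : 0 < gamma.
Hypothesis Hchi : poisson_arrivals gamma chi.
Hypothesis err_perturb : forall chi chi' L r,
  valid_arrivals chi -> valid_arrivals chi' -> 0 <= r ->
  (forall k, (k <= L)%N -> `|chi k - chi' k| <= r) ->
  (err chi <= err chi' + (error_bound gamma K s L r)%:E)%E.
Hypothesis err_grid : (err (grid gamma) <= 0)%E.
Hypothesis K0 : 0 < K.

Lemma valid_poisson_arrivals w : valid_arrivals (fun n => chi n w).
Proof.
have mono : forall m n, (m <= n)%N -> chi m w <= chi n w.
  move=> m n /subnK <-; elim: (n - m)%N => // k IH.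
  by apply: le_trans IH _; rewrite addSn; exact/ltW/(arrivals_lt Hchi).
by split=> // n; rewrite -(arrivals0 Hchi w); exact: mono.
Qed.

(** If every arrival time up to [L] is within [r] of the grid, stability keeps the error below [t].
    The error event is therefore covered by [L + 1] deviation events. *)
Lemma error_event_bound (t : R) L r u : 0 <= r -> 0 <= u <= 1 / 2 ->
  error_bound gamma K s L r < t ->
  (P [set w | (t%:E <= err (fun n => chi n w))%E] <=
    (2 * L.+1%:R * expR (2 * L%:R * u ^+ 2 - u * gamma * r))%:E)%E.
Proof.
move=> r0 u01 bt.
have mE : measurable [set w | (t%:E <= err (fun n => chi n w))%E].
  by apply: (measurable_perturbation gamma_gt0 K0 _ valid_poisson_arrivals err_perturb).
pose D k := [set w | (r < `|chi k w - k%:R / gamma|)%R].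
have mD k : measurable (D k).
  have mc : measurable_fun setT (fun w => `|chi k w - k%:R / gamma|).
    by apply: measurableT_comp => //; exact: measurable_funB.
  rewrite (_ : D k = (fun w => `|chi k w - k%:R / gamma|) @^-1` `]r, +oo[%classic).
    by rewrite -[X in measurable X]setTI; exact: mc.
  by apply/seteqP; split=> w /=; rewrite in_itv/= andbT.
apply: (@le_trans _ _ (\sum_(k < L.+1) P (D k))%E).
  apply: content_subadditive => // w /= tw; rewrite -bigcup_mkord.
  apply: contrapT => nD; move: tw; apply/negP; rewrite -ltNge.
  apply: (@le_lt_trans _ _ (error_bound gamma K s L r)%:E); last by rewrite lte_fin.
  rewrite -[leRHS]add0e; apply: le_trans (leeD err_grid (lexx _)).
  apply: err_perturb => //; [exact: valid_poisson_arrivals|exact: valid_grid|].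
  move=> k kL; rewrite leNgt; apply/negP => rk; apply: nD.
  by exists k; rewrite //= ltnS.
apply: (@le_trans _ _ (\sum_(k < L.+1) (2 * expR (2 * L%:R * u ^+ 2 - u * gamma * r))%:E)%E).
  apply: lee_sum => k _; apply: le_trans (arrivals_deviation gamma_gt0 Hchi k r u01) _.
  rewrite lee_fin ler_wpM2l// ler_expR lerD2r ler_wpM2r ?sqr_ge0//.
  by rewrite ler_wpM2l// ler_nat -ltnS.
by rewrite sumEFin sumr_const card_ord lee_fin -mulr_natr; lra.
Qed.

End deviation_event.

(** * Choice of the parameters for large [gamma] *)

Section asymptotics.
Context (R : realType).
Variables (K q eps s c gamma : R).
Hypotheses (K0 : 0 < K) (q1 : 1 < q) (eps0 : 0 < eps) (s0 : 0 <= s) (c0 : 0 < c).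

Let e : R := expR 1.

(** The factor [6 * K] is [2 * 3 * K] from [error_bound], [q + 2] comes from [deviation], and
    [e + 2] from the cutoff through [s * e + 2 <= (s + 1) * (e + 2)]. The final 1 absorbs the
    Poisson tail. *)
Definition rate_constant : R := 6 * K * (e + 2) * (q + 2) + 1.

(* Beyond [e * gamma * s + gamma] the Poisson weights of parameter [gamma * s]
   have total mass at most [e ^ (- gamma)]. *)
Definition cutoff : nat := (Num.trunc ((s * e + 1) * gamma)).+1.

(* The Chernoff bound at [u = 1 / sqrt gamma] turns this deviation into the
   probability [gamma ^ (- (q + 2))], which survives the union bound over the
   O([gamma]) first arrivals. *)
Definition deviation : R := (q + 2) * ln gamma * (Num.sqrt gamma)^-1.

(** The three thresholds ensure, in order, that [1 / sqrt gamma] is an admissible Chernoff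
    parameter, that [1 <= ln gamma], and that the spare factor [gamma^-1] in the probability beats
    [c]. *)
Hypothesis gamma4 : 4 <= gamma.
Hypothesis gammae : e <= gamma.
Hypothesis gammac : 2 * (s * e + 3) * expR (2 * (s * e + 2)) / c <= gamma.

Let g := Num.sqrt gamma.
Let gamma_gt0 : 0 < gamma. Proof. exact: lt_le_trans gamma4. Qed.
Let g2 : g ^+ 2 = gamma. Proof. by rewrite sqr_sqrtr// ltW. Qed.
Let g_ge2 : 2 <= g.
Proof.
have h := gamma4.
have -> : 2 = Num.sqrt (2 ^+ 2) :> R by rewrite sqrtr_sqr ger0_norm.
by apply: ler_wsqrtr; rewrite expr2; lra.
Qed.
Let g_gt0 : 0 < g. Proof. by apply: lt_le_trans g_ge2. Qed.
Let e0 : 0 < e. Proof. exact: expR_gt0. Qed.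
Let ln_ge1 : 1 <= ln gamma.
Proof. by rewrite -[leLHS]expRK ler_ln ?posrE. Qed.

Lemma cutoff_ge : (s * e + 1) * gamma <= cutoff%:R.
Proof. by apply: ltW; exact: Num.Theory.truncnS_gt. Qed.

Lemma cutoff_le : cutoff%:R <= (s * e + 2) * gamma.
Proof.
have h : 0 <= (s * e + 1) * gamma.
  apply: mulr_ge0; last exact: ltW.
  by rewrite addr_ge0// mulr_ge0// ltW.
have /andP[h1 _] := Num.Theory.truncn_itv h.
rewrite /cutoff -natr1; have := gamma4; lra.
Qed.

Lemma deviation_ge0 : 0 <= deviation.
Proof. by rewrite /deviation !mulr_ge0 ?invr_ge0//; have := q1; have := ln_ge1; lra. Qed.

Lemma inv_sqrt_le_half : 0 <= g^-1 <= 1 / 2.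
Proof. by rewrite invr_ge0 ltW//= ler_pdivlMr// mulrC ler_pdivrMr// mul1r. Qed.

Lemma inv_sqrt_le_powR : g^-1 <= gamma `^ (- (1 / 2) + eps / 2).
Proof.
have -> : g^-1 = gamma `^ (- (1 / 2)) by rewrite powRN mul1r powR12_sqrt// ltW.
by apply: ler_powR; have := gamma4; have := eps0; lra.
Qed.

Lemma error_bound_lt_threshold :
  error_bound gamma K s cutoff deviation <
  (s + 1) * rate_constant * ln gamma * gamma `^ (- (1 / 2) + eps / 2).
Proof.
set l := ln gamma; have l1 : 1 <= l by [].
have [h1 h2 h3 h4] : [/\ 4 <= gamma, 1 < q, 0 <= s & 0 < K] by [].
have h5 := e0.
have gi0 : 0 < g^-1 by rewrite invr_gt0.
have main : cutoff%:R * (2 * (gamma^-1 * (K * (3 * deviation)))) <=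
    (s + 1) * (6 * K * (e + 2) * (q + 2)) * l * g^-1.
  apply: (@le_trans _ _ ((s * e + 2) * gamma * (2 * (gamma^-1 * (K * (3 * deviation)))))).
    apply: ler_wpM2r cutoff_le; have d0 := deviation_ge0; have gv0 : 0 <= gamma^-1 by rewrite invr_ge0 ltW.
    do 2 apply: mulr_ge0 => //.
    by apply: mulr_ge0; [exact: ltW|exact: mulr_ge0].
  have -> : (s * e + 2) * gamma * (2 * (gamma^-1 * (K * (3 * deviation)))) =
      (s * e + 2) * (6 * K * (q + 2) * l * g^-1).
    by rewrite /deviation -/g -/l; field; rewrite !gt_eqF.
  have -> : (s + 1) * (6 * K * (e + 2) * (q + 2)) * l * g^-1 =
      ((s + 1) * (e + 2)) * (6 * K * (q + 2) * l * g^-1) by ring.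
  apply: ler_wpM2r; first by rewrite !mulr_ge0//; lra.
  have : 0 <= s * e by rewrite mulr_ge0// ltW.
  lra.
(* By the choice of the cutoff the exponent is at most [- gamma], and [2 * expR (- gamma) < 2 /
   gamma <= 1 / sqrt gamma] because [sqrt gamma >= 2]. *)
have tail : 2 * expR (gamma * s * (expR 1 - 1) - cutoff%:R) < l * g^-1.
  apply: (@le_lt_trans _ _ (2 * expR (- gamma))).
    rewrite ler_wpM2l// ler_expR; have := cutoff_ge; rewrite -/e.
    have : 0 <= gamma * s by rewrite mulr_ge0// ltW.
    lra.
  rewrite expRN; apply: (@lt_le_trans _ _ (2 / gamma)).
    rewrite ltr_pM2l// ltf_pV2 ?posrE ?expR_gt0//.
    by apply: lt_le_trans (expR_ge1Dx _); lra.
  rewrite -g2 expr2 invfM mulrA; apply: ler_wpM2r; first exact: ltW.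
  by apply: le_trans l1; rewrite ler_pdivrMr// mul1r.
apply: (@lt_le_trans _ _ ((s + 1) * rate_constant * l * g^-1)).
  rewrite /error_bound /rate_constant.
  have : l * g^-1 <= (s + 1) * (l * g^-1).
    by rewrite ler_peMl ?mulr_ge0//; lra.
  lra.
apply: ler_wpM2l inv_sqrt_le_powR.
rewrite !mulr_ge0 ?addr_ge0 ?mulr_ge0//; lra.
Qed.

(** With [u = 1 / sqrt gamma] the quadratic term of the exponent is at most [2 * (s * e + 2)], a
    constant, and the linear one gives [gamma ^ (- (q + 2))]. The union bound costs one power of
    [gamma]; one more is left to absorb the constants and [c]. *)
Lemma deviation_probability_le :
  2 * cutoff.+1%:R * expR (2 * cutoff%:R * g^-1 ^+ 2 - g^-1 * gamma * deviation)
    <= c * gamma `^ (- q).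
Proof.
have -> : g^-1 * gamma * deviation = (q + 2) * ln gamma.
  by rewrite /deviation -/g -[X in _ * X * _]g2; field; rewrite gt_eqF.
have gi : g^-1 ^+ 2 = gamma^-1 by rewrite exprVn g2.
have se0 : 0 <= s * e by rewrite mulr_ge0// ltW.
have h := gamma4.
apply: (@le_trans _ _ (2 * ((s * e + 3) * gamma) *
    (expR (2 * (s * e + 2)) * (gamma `^ (- q) * (gamma^-1 * gamma^-1))))).
  apply: ler_pM; rewrite ?mulr_ge0 ?expR_ge0//.
    by rewrite ler_wpM2l//; have := cutoff_le; rewrite -[in X in _ -> X]natr1; lra.
  have -> : gamma `^ (- q) * (gamma^-1 * gamma^-1) = expR (- ((q + 2) * ln gamma)).
    rewrite /powR gt_eqF// -[gamma in gamma^-1]lnK ?posrE// -!expRN -!expRD.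
    by congr expR; ring.
  rewrite -expRD ler_expR lerD2r gi -mulrA ler_wpM2l//.
  by rewrite ler_pdivrMr//; exact: cutoff_le.
rewrite [leLHS](_ : _ = (2 * (s * e + 3) * expR (2 * (s * e + 2)) * gamma^-1) * gamma `^ (- q)).
  rewrite ler_wpM2r ?powR_ge0//.
  by rewrite ler_pdivrMr// [c * _]mulrC -ler_pdivrMr.
by field; rewrite gt_eqF.
Qed.

End asymptotics.

Theorem theorem5p1 (R : realType)
    (dJ : measure_display) (J : measurableType dJ)
    (dO : measure_display) (Omega : measurableType dO) (P : probability Omega R)
    (Lambda : R -> R -> J -> {charge set J -> \bar R}) (gamma0 : R)
    (chi : R -> nat -> {RV P >-> R})
    (singletons : forall x : J, measurable [set x])
    (HLambda : intensity_family gamma0 Lambda)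
    (Hchi : forall gamma : R, 0 < gamma -> gamma0 <= gamma ->
      poisson_arrivals gamma (chi gamma))
    (q eps : R) (hq : 1 < q) (heps : 0 < eps) :
  exists alpha' : R, forall s v : R, 0 <= v -> v <= s ->
    let threshold (gamma : R) : R :=
      (s + 1) * alpha' * ln gamma * gamma `^ (- (1 / 2) + eps / 2) in
    (forall c : R, 0 < c -> \forall gamma \near +oo_R,
      (P [set w | (threshold gamma)%:E
                    <= error_a gamma Lambda (fun n => chi gamma n w) s]
        <= (c * gamma `^ (- q))%:E)%E) /\
    (forall c : R, 0 < c -> \forall gamma \near +oo_R,
      (P [set w | (threshold gamma)%:E
                    <= error_c gamma Lambda (fun n => chi gamma n w) s v]
        <= (c * gamma `^ (- q))%:E)%E).
Proof.
have [K K0 lipK] := intensity_lipschitz HLambda.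
exists (rate_constant K q) => s v v0 vs threshold.
have s0 : 0 <= s by exact: le_trans vs.
(* Only stability and the value on the grid matter, so both errors are treated by one argument. *)
have bound (err : R -> (nat -> R) -> \bar R) :
  (forall gamma, 0 < gamma -> gamma0 <= gamma ->
    (forall chi chi' L r, valid_arrivals chi -> valid_arrivals chi' -> 0 <= r ->
      (forall k, (k <= L)%N -> `|chi k - chi' k| <= r) ->
      (err gamma chi <= err gamma chi' + (error_bound gamma K s L r)%:E)%E) /\
    (err gamma (grid gamma) <= 0)%E) ->
  forall c : R, 0 < c -> \forall gamma \near +oo_R,
    (P [set w | (threshold gamma)%:E <= err gamma (fun n => chi gamma n w)]
      <= (c * gamma `^ (- q))%:E)%E.
  move=> herr c c0; near=> gamma.
  have g4 : 4 <= gamma by near: gamma; apply: nbhs_pinfty_ge; exact: num_real.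
  have ge : expR 1 <= gamma by near: gamma; apply: nbhs_pinfty_ge; exact: num_real.
  have gc : 2 * (s * expR 1 + 3) * expR (2 * (s * expR 1 + 2)) / c <= gamma.
    by near: gamma; apply: nbhs_pinfty_ge; exact: num_real.
  have g0 : gamma0 <= gamma by near: gamma; apply: nbhs_pinfty_ge; exact: num_real.
  have gpos : 0 < gamma by lra.
  have [perturb grid0] := herr gamma gpos g0.
  apply: le_trans (error_event_bound gpos (Hchi gamma gpos g0) perturb grid0 K0
    (deviation_ge0 hq g4 ge) (inv_sqrt_le_half g4)
    (error_bound_lt_threshold K0 hq heps s0 g4 ge)) _.
  by rewrite lee_fin; exact: (deviation_probability_le q s0 c0 g4 gc).
split; [apply: (bound (fun gamma chi => error_a gamma Lambda chi s))
  |apply: (bound (fun gamma chi => error_c gamma Lambda chi s v))] => gamma gpos g0; split.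
- move=> chi1 chi2 L r vc1 vc2 r0 hr.
  exact: (error_a_perturb singletons HLambda gpos g0 K0 lipK vc1 vc2 r0 hr).
- exact: (error_a_grid singletons HLambda gpos g0 K0 lipK).
- move=> chi1 chi2 L r vc1 vc2 r0 hr.
  apply: (error_c_perturb singletons HLambda gpos g0 K0 lipK vc1 vc2 r0 hr).
  by rewrite v0.
- by apply: (error_c_grid singletons HLambda gpos g0 K0 lipK); rewrite v0.
Unshelve. all: by end_near.
Qed.
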